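(* Suppose $\mu$ is a doubling measure on $\mathbb{R}^n$ and $\mathcal{D}$ and $\mathcal{E}$ are dyadic grids on $\mathbb{R}^n$. Then for $\kappa\in\mathbb{N}$ and $|s|$ sufficiently small (depending on $\mu$), we have $$W^s_{\mathcal{D};\kappa}(\mu)=W^s_{\mathcal{E};\kappa}(\mu).$$
   Context: $\ell(Q)$ is the side length of a cube $Q$, $|E|_\mu=\mu(E)$, and $cQ$ is the concentric dilate. A positive locally finite Borel measure $\mu$ on $\mathbb{R}^n$ is doubling if there is $C_{\mathrm{doub}}$ with $|2Q|_\mu\le C_{\mathrm{doub}}|Q|_\mu$ for all cubes $Q$ with sides parallel to the axes. For $\kappa\in\mathbb{N}=\{1,2,\dots\}$ and a cube $Q$ in a dyadic grid $\mathcal{D}$ with dyadic children $\mathfrak{C}(Q)$, $L^2_{Q;\kappa}(\mu)$ is the finite dimensional space of functions $f=\sum_{Q'\in\mathfrak{C}(Q)}\mathbf 1_{Q'}p_{Q'}$, with each $p_{Q'}$ a polynomial of degree less than $\kappa$, such that $\int_Q f(x)x^\beta d\mu(x)=0$ for all multiindices $0\le|\beta|<\kappa$. The Alpert projection $\triangle^\mu_{Q;\kappa}$ is the orthogonal projection in $L^2(\mu)$ onto $L^2_{Q;\kappa}(\mu)$. For $s\in\mathbb{R}$, $W^s_{\mathcal{D};\kappa}(\mu)$ is the Hilbert space completion of the functions $f\in L^2(\mu)$ with finite norm $$\|f\|^2_{W^s_{\mathcal{D};\kappa}(\mu)}=\sum_{Q\in\mathcal{D}}\ell(Q)^{-2s}\|\triangle^\mu_{Q;\kappa}f\|^2_{L^2(\mu)}.$$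 Equality of two such completions is understood with equivalence of norms. *)

(* Defs.v *)
From mathcomp Require Import all_boot all_order all_algebra.
From mathcomp Require Import all_classical all_reals all_analysis.
(* Only instances and coercions are imported: the notations clash with those of
   mathcomp-analysis. *)
From mathcomp Require Import (canonicals, coercions) mpoly.

Set Implicit Arguments.
Unset Strict Implicit.
Unset Printing Implicit Defensive.
Import Order.TTheory GRing.Theory Num.Theory.
Import numFieldNormedType.Exports.
Local Open Scope classical_set_scope.
Local Open Scope ring_scope.

(* R^n with its Borel sigma-algebra. *)
Notation euclid R n := (g_sigma_algebraType (@open 'rV[R]_n)).

Section cubes.
Context {R : realType} {n : nat}.

(* The pair (c, l) stands for the half-open cube
   [c_1, c_1 + l) x ... x [c_n, c_n + l). *)
Definition cube := ('rV[R]_n * {posnum R})%type.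

Definition side (Q : cube) : R := Q.2%:num.

Definition points (Q : cube) : set (euclid R n) :=
  [set x : 'rV[R]_n | forall i, Q.1 ord0 i <= x ord0 i < Q.1 ord0 i + side Q].

Definition dilate (a : {posnum R}) (Q : cube) : cube :=
  (Q.1 + const_mx ((1 - a%:num) / 2 * side Q), (a%:num * Q.2%:num)%:pos).

Definition dyadic_grid (D : set cube) : Prop :=
  [/\ forall Q, D Q -> exists j : int, side Q = 2 ^ j,
      forall (j : int) (x : 'rV[R]_n),
        exists! Q, [/\ D Q, side Q = 2 ^ j & points Q x]
    & forall P Q, D P -> D Q ->
        [\/ points P `&` points Q = set0,
            points P `<=` points Q | points Q `<=` points P]].

Definition children (D : set cube) (Q : cube) : set cube :=
  [set P | [/\ D P, points P `<=` points Q & side P = side Q / 2]].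

Definition locally_finite (mu : {measure set (euclid R n) -> \bar R}) : Prop :=
  forall x : 'rV[R]_n, exists U : set 'rV[R]_n,
    [/\ open U, U x & (mu U < +oo)%E].

Definition doubling (mu : {measure set (euclid R n) -> \bar R}) : Prop :=
  exists C : R, forall Q : cube,
    (mu (points (dilate 2%:pos%R Q)) <= C%:E * mu (points Q))%E.

End cubes.
Arguments cube : clear implicits.

Section alpert.
Context {R : realType} {n : nat}.
Variable mu : {measure set (euclid R n) -> \bar R}.
Implicit Types (D : set (cube R n)) (Q : cube R n) (k : nat) (s : R).
Implicit Types f g : euclid R n -> R.

Definition monomial (b : mpoly.multinom n) (x : 'rV[R]_n) : R :=
  \prod_(i < n) x ord0 i ^+ b i.

(* [msize] is one more than the total degree, and 0 for the zero polynomial. *)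
Definition alpert_space D k Q : set (euclid R n -> R) :=
  [set f | (exists p : cube R n -> mpoly.mpoly n R,
              (forall P, (mpoly.msize (p P) <= k)%N) /\
              f = fun x : 'rV[R]_n =>
                \sum_(P \in children D Q)
                  \1_(points P) x * mpoly.meval (x ord0) (p P)) /\
           (forall b : mpoly.multinom n, (mpoly.mdeg b < k)%N ->
              (\int[mu]_(x in points Q) (f x * monomial b x)%:E = 0)%E)].

Definition is_alpert_proj D k Q f g : Prop :=
  alpert_space D k Q g /\
  forall h, alpert_space D k Q h -> (\int[mu]_x ((f x - g x) * h x)%:E = 0)%E.

(* For f in L^2(mu) the projection is unique up to mu-null sets; [get] picks a
   representative. *)
Definition alpert_proj D k Q f : euclid R n -> R :=
  get (is_alpert_proj D k Q f).

Definition alpert_norm D k s f : \bar R :=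
  ((\esum_(Q in D) ((side Q `^ (- 2 * s))%:E *
      'N[mu]_2%:E[EFin \o alpert_proj D k Q f] ^+ 2)) `^ 2^-1)%E.

Definition pre_sobolev D k s : set (euclid R n -> R) :=
  [set f | f \in Lfun mu 2%:E /\ (alpert_norm D k s f < +oo)%E].

Definition sobolev_cauchy D k s (u : nat -> euclid R n -> R) : Prop :=
  (forall i, pre_sobolev D k s (u i)) /\
  forall e : R, 0 < e -> exists N : nat, forall i j : nat,
    (N <= i)%N -> (N <= j)%N -> (alpert_norm D k s (u i \- u j)%R <= e%:E)%E.

Definition sobolev_class D k s (u : nat -> euclid R n -> R) :
    set (nat -> euclid R n -> R) :=
  [set v | sobolev_cauchy D k s v /\
     alpert_norm D k s (u i \- v i)%R @[i --> \oo] --> 0%E].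

(* The completion W^s_{D;k}(mu): its elements are the classes of Cauchy
   sequences modulo sequences tending to 0 in norm, its vector space operations
   are the termwise ones, and the constant sequences embed [pre_sobolev]. An
   element being a set of sequences of functions, the completions for two grids
   can be compared with Leibniz equality. *)
Definition sobolev D k s : set (set (nat -> euclid R n -> R)) :=
  [set sobolev_class D k s u | u in sobolev_cauchy D k s].

(* The limit does not depend on the sequence chosen in the class. *)
Definition sobolev_norm D k s (F : set (nat -> euclid R n -> R)) : \bar R :=
  lim (alpert_norm D k s (get F i) @[i --> \oo]).

End alpert.

(* Main.v *)
Require Import Defs.
From mathcomp Require Import all_boot all_order all_algebra.
From mathcomp Require Import all_classical all_reals all_analysis.
From mathcomp Require Import measurable_realfun qpoly.
From mathcomp Require Import (canonicals, coercions) mpoly.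
From mathcomp Require Import ring lra zify.

Set Implicit Arguments.
Unset Strict Implicit.
Unset Printing Implicit Defensive.
Import Order.TTheory GRing.Theory Num.Theory.
Import numFieldNormedType.Exports.
Local Open Scope classical_set_scope.
Local Open Scope ring_scope.

(** Functions of the Alpert basis of a grid oscillate: they are orthogonal to the
    polynomials of degree less than [k] on their cube. Hence the Alpert functions
    of two different grids are almost orthogonal when their scales are far apart.
    Take a sum of Alpert functions of [D] at scale [2 ^ i] and one of Alpert
    functions of [E] at a larger scale [2 ^ j]. The second sum is a polynomial on
    each child of a cube of [E], so that only the cubes of [D] that cross the
    boundary of such a child contribute; they lie in a layer of relative width
    about [2 ^ (i - j)] along this boundary. The mass of the layer is a proportion
    at most of order [rho ^ (j - i)] with [rho < 1], because for a doubling measure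
    the half of a cube away from a face carries a fixed proportion of the mass, at
    every scale ([mass_slab]). The square of a polynomial of bounded degree does
    not concentrate on the layer either ([polyfun_mass]). This gives
    [|<phi, psi>| <= c r ^ |i - j| |phi| |psi|] with [r] the square root of [rho]
    ([level_estimate], [level_bound]).

    For [f] in [L2], a finite part [X] of the squared Sobolev norm for [D] equals
    [<f, Phi>], where [Phi] is the sum of the projections of [f] multiplied by the
    weights. As [Phi] is approximated in [L2] by Alpert functions of [E], this is
    up to a small error a sum of the inner products of [Phi] with finitely many
    projections of [f] for [E] ([alpert_complete]). Grouping the cubes by scales,
    the almost orthogonality and Schur's test bound it by [X / 2] plus a multiple
    of the squared norm for [E] ([energy_le]), provided that [r 2 ^ |s| < 1], a
    condition that only involves [s] and the doubling constant.

    The approximation holds because [Phi] is a finite sum of polynomials on cubes.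
    Up to a thin layer such a cube is a union of small cubes of [E]
    ([cube_poly_closure]). A polynomial on a cube of [E] is, modulo Alpert functions
    of its ancestors, its projection onto the polynomials on a distant ancestor,
    and this tends to zero because the masses of the ancestors grow geometrically
    ([grid_poly_closure]).

    Exchanging the grids, the two norms are equivalent on [L2] ([alpert_norm_le]),
    so that the Cauchy sequences and the null sequences are the same and the
    completions coincide; the norms of a class are limits of equivalent norms. *)

(** * Square integrable functions *)

Section square_integrable.
Context d (T : measurableType d) (R : realType).
Variable mu : {measure set T -> \bar R}.
Implicit Types (f g h : T -> R) (A : set T).

Local Notation L2 := (Lfun mu 2%:E).

Lemma L2_submod : submod_closed L2.
Proof. exact: (@Lfun_submod_closed _ _ _ mu 2%:E (lee1n 2)). Qed.

Lemma L2_0 : (0 : T -> R) \in L2.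
Proof. exact: L2_submod.1. Qed.

Lemma L2Z a f : f \in L2 -> a *: f \in L2.
Proof. by move=> L2f; rewrite -[_ *: _]addr0; exact: L2_submod.2 L2_0. Qed.

Lemma L2D f g : f \in L2 -> g \in L2 -> f + g \in L2.
Proof. by move=> L2f; rewrite -[f]scale1r; exact: L2_submod.2. Qed.

Lemma L2B f g : f \in L2 -> g \in L2 -> f - g \in L2.
Proof. by move=> L2f L2g; rewrite -scaleN1r; apply: L2D => //; exact: L2Z. Qed.

Lemma L2_sum (I : eqType) (s : seq I) (P : pred I) (F : I -> T -> R) :
  (forall i, i \in s -> P i -> F i \in L2) -> \sum_(i <- s | P i) F i \in L2.
Proof.
move=> L2F; rewrite big_seq_cond.
elim/big_rec: _ => [|i f /andP[si Pi] L2f]; first exact: L2_0.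
by apply: L2D => //; exact: L2F.
Qed.

Lemma L2_measurable f : f \in L2 -> measurable_fun setT f.
Proof. by move=> /sub_Lfun_mfun; rewrite inE. Qed.

Lemma integrable_mul f g : f \in L2 -> g \in L2 ->
  mu.-integrable setT (EFin \o (f \* g)).
Proof. by move=> L2f L2g; apply/Lfun1_integrable; exact: Lfun2_mul_Lfun1. Qed.

Lemma L2P f : measurable_fun setT f ->
  (\int[mu]_x (f x ^+ 2)%:E < +oo)%E -> f \in L2.
Proof.
move=> mf ioo; rewrite inE; apply/andP; split; rewrite inE//=.
rewrite /finite_norm unlock poweR_lty//.
by under eq_integral => x _ do rewrite /= powR_mulrn// real_normK ?num_real//.
Qed.

Lemma L2_le f g : f \in L2 -> measurable_fun setT g ->
  (forall x, `|g x| <= `|f x|) -> g \in L2.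
Proof.
move=> L2f mg gf; apply: L2P => //.
have /integrableP[_ /=] := integrable_mul L2f L2f.
apply: le_lt_trans; apply: ge0_le_integral => //.
- by move=> x _; rewrite lee_fin sqr_ge0.
- by apply/measurable_EFinP; exact: measurable_funX.
- apply/measurable_EFinP; apply: measurableT_comp => //.
  by apply: measurable_funM; exact: L2_measurable.
- move=> x _; rewrite lee_fin -expr2 normrX -[_ ^+ 2]ger0_norm ?sqr_ge0//.
  by rewrite normrX ler_pXn2r ?nnegrE.
Qed.

Lemma L2_indic f A : f \in L2 -> measurable A -> f \* \1_A \in L2.
Proof.
move=> L2f mA; apply: (L2_le L2f).
  by apply: measurable_funM; [exact: L2_measurable | exact: measurable_indic].
move=> x /=; rewrite indicE normrM; case: (_ \in _); rewrite ?normr1 ?mulr1//.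
by rewrite normr0 mulr0.
Qed.

Lemma L2_bounded f A (M : R) : measurable A -> (mu A < +oo)%E ->
  measurable_fun setT f -> (forall x, A x -> `|f x| <= M) ->
  (forall x, ~ A x -> f x = 0) -> f \in L2.
Proof.
move=> mA Aoo mf fM f0; apply: L2P => //.
have : (\int[mu]_x (M ^+ 2 * \1_A x)%:E < +oo)%E.
  under eq_integral => x _ do rewrite EFinM.
  rewrite ge0_integralZl//; last by rewrite lee_fin sqr_ge0.
  - rewrite integral_indic// setIT lte_mul_pinfty// lee_fin.
    exact: sqr_ge0.
  - by apply/measurable_EFinP; exact: measurable_indic.
apply: le_lt_trans; apply: ge0_le_integral => //.
- by move=> x _; rewrite lee_fin sqr_ge0.
- by apply/measurable_EFinP; exact: measurable_funX.
- by apply/measurable_EFinP; apply: measurable_funM.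
move=> x _; rewrite lee_fin indicE.
have [Ax|nAx] := pselect (A x).
  rewrite mem_set// mulr1 -[leLHS]ger0_norm ?sqr_ge0// normrX.
  by rewrite ler_pXn2r ?nnegrE ?fM// (le_trans _ (fM _ Ax)).
by rewrite f0// memNset// mulr0 expr0n.
Qed.

(** * Inner product *)

Definition dot f g : R := \int[mu]_x (f x * g x).

Lemma dot_EFin f g : f \in L2 -> g \in L2 ->
  (\int[mu]_x (f x * g x)%:E)%E = (dot f g)%:E.
Proof.
by move=> L2f L2g; rewrite fineK//; apply: integrable_fin_num => //;
  exact: integrable_mul.
Qed.

Lemma dotC f g : dot f g = dot g f.
Proof. by apply: eq_Rintegral => x _; rewrite mulrC. Qed.

Lemma dotDl f g h : f \in L2 -> g \in L2 -> h \in L2 ->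
  dot (f + g) h = dot f h + dot g h.
Proof.
move=> L2f L2g L2h.
rewrite /dot -RintegralD//; [|exact: integrable_mul..].
by apply: eq_Rintegral => x _; rewrite mulrDl.
Qed.

Lemma dotZl a f g : f \in L2 -> g \in L2 -> dot (a *: f) g = a * dot f g.
Proof.
move=> L2f L2g; rewrite /dot -RintegralZl//; last exact: integrable_mul.
by apply: eq_Rintegral => x _; rewrite -mulrA.
Qed.

Lemma dotBl f g h : f \in L2 -> g \in L2 -> h \in L2 ->
  dot (f - g) h = dot f h - dot g h.
Proof.
by move=> *; rewrite -scaleN1r dotDl ?dotZl ?mulN1r//; exact: L2Z.
Qed.

Lemma dot0l g : dot 0 g = 0.
Proof.
rewrite /dot; under eq_Rintegral => x _ do rewrite mul0r.
by rewrite /Rintegral integral0.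
Qed.

Lemma dotDr f g h : f \in L2 -> g \in L2 -> h \in L2 ->
  dot h (f + g) = dot h f + dot h g.
Proof. by move=> *; rewrite !(dotC h) dotDl. Qed.

Lemma dotBr f g h : f \in L2 -> g \in L2 -> h \in L2 ->
  dot h (f - g) = dot h f - dot h g.
Proof. by move=> *; rewrite !(dotC h) dotBl. Qed.

Lemma dotZr a f g : f \in L2 -> g \in L2 -> dot g (a *: f) = a * dot g f.
Proof. by move=> *; rewrite !(dotC g) dotZl. Qed.

Lemma dot0r g : dot g 0 = 0. Proof. by rewrite dotC dot0l. Qed.

Lemma dot_suml (I : eqType) (s : seq I) (P : pred I) (F : I -> T -> R) g :
  (forall i, i \in s -> P i -> F i \in L2) -> g \in L2 ->
  dot (\sum_(i <- s | P i) F i) g = \sum_(i <- s | P i) dot (F i) g.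
Proof.
move=> L2F L2g; elim: s L2F => [|i s IH] L2F; first by rewrite !big_nil dot0l.
have L2s j : j \in s -> P j -> F j \in L2.
  by move=> js; apply: L2F; rewrite inE js orbT.
rewrite !big_cons; case: ifPn => Pi; last exact: IH.
by rewrite dotDl ?IH//; [apply: L2F; rewrite ?mem_head | exact: L2_sum].
Qed.

Lemma dot_sumr (I : eqType) (s : seq I) (P : pred I) (F : I -> T -> R) g :
  (forall i, i \in s -> P i -> F i \in L2) -> g \in L2 ->
  dot g (\sum_(i <- s | P i) F i) = \sum_(i <- s | P i) dot g (F i).
Proof.
by move=> *; rewrite dotC dot_suml//; apply: eq_bigr => i _; rewrite dotC.
Qed.

Lemma dot_ge0 f : 0 <= dot f f.
Proof. by apply: Rintegral_ge0 => x _; rewrite -expr2 sqr_ge0. Qed.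

Lemma le_dot f g h l : f \in L2 -> g \in L2 -> h \in L2 -> l \in L2 ->
  (forall x, f x * g x <= h x * l x) -> dot f g <= dot h l.
Proof.
by move=> *; apply: le_Rintegral => //; exact: integrable_mul.
Qed.

Lemma eq_dot f g h l : (forall x, f x * g x = h x * l x) ->
  dot f g = dot h l.
Proof. by move=> e; apply: eq_Rintegral => x _; exact: e.
Qed.

Lemma dot_eq0 f g : (forall x, f x * g x = 0) -> dot f g = 0.
Proof.
by move=> e; rewrite -[RHS](dot0l 0); apply: eq_dot => x; rewrite e; exact/esym/mul0r.
Qed.

Lemma pythagoras (I : eqType) (s : seq I) (F : I -> T -> R) : uniq s ->
  (forall i, i \in s -> F i \in L2) ->
  (forall i j, i \in s -> j \in s -> i != j -> dot (F i) (F j) = 0) ->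
  dot (\sum_(i <- s) F i) (\sum_(i <- s) F i) = \sum_(i <- s) dot (F i) (F i).
Proof.
move=> us L2F oF; have L2s : \sum_(i <- s) F i \in L2.
  by apply: L2_sum => i si _; exact: L2F.
rewrite dot_suml//; last by move=> i si _; exact: L2F.
apply: eq_big_seq => i si; rewrite dot_sumr; [|by move=> j sj _; exact: L2F|exact: L2F].
rewrite (bigD1_seq i)//= big_seq_cond big1 ?addr0// => j /andP[sj ji].
by rewrite oF// eq_sym.
Qed.

(** The discriminant of the nonnegative quadratic polynomial
    [t |-> |g - t f|^2] is nonpositive. *)
Lemma cauchy_schwarz f g : f \in L2 -> g \in L2 ->
  dot f g ^+ 2 <= dot f f * dot g g.
Proof.
move=> L2f L2g.
have q t : 0 <= dot g g - 2 * t * dot f g + t ^+ 2 * dot f f.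
  have := dot_ge0 (g - t *: f).
  have L2tf : t *: f \in L2 by exact: L2Z.
  rewrite dotBl ?L2B// !dotBr// !dotZl// !dotZr// (dotC g f).
  by rewrite (_ : _ - _ = dot g g - 2 * t * dot f g + t ^+ 2 * dot f f)//; ring.
have [f0|f0] := eqVneq (dot f f) 0.
  have [->|fg0] := eqVneq (dot f g) 0.
    by rewrite expr0n/= mulr_ge0 ?dot_ge0.
  have := q ((dot g g + 1) / (2 * dot f g)); rewrite f0 mulr0 addr0.
  rewrite (_ : 2 * _ * _ = dot g g + 1); first by lra.
  by field.
have fp : 0 < dot f f by rewrite lt_def f0 dot_ge0.
have := q (dot f g / dot f f).
rewrite (_ : _ + _ = (dot f f * dot g g - dot f g ^+ 2) / dot f f).
  by rewrite ler_pdivlMr// mul0r subr_ge0.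
by field.
Qed.

(** Expand [|t f - g|^2 >= 0]. The free weight [t] gives the triangle inequality
    after optimization, and is what survives summation over cubes. *)
Lemma dot_sqrD f g t : f \in L2 -> g \in L2 -> 0 < t ->
  dot (f + g) (f + g) <= (1 + t) * dot f f + (1 + t^-1) * dot g g.
Proof.
move=> L2f L2g t0.
have := dot_ge0 (t *: f - g).
have L2tf : t *: f \in L2 by exact: L2Z.
rewrite dotBl ?L2B// !dotBr// !dotZl// !dotZr// (dotC g f) => h.
rewrite dotDl ?L2D// !dotDr// (dotC g f).
rewrite -subr_ge0 -(pmulr_rge0 _ t0).
apply: (le_trans h); rewrite le_eqVlt; apply/orP; left; apply/eqP.
by field; rewrite gt_eqF.
Qed.

(** Functions are not identified almost everywhere, so that [dot] is only
    semidefinite; null vectors are harmless in the orthogonalization below. *)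
Lemma dot_null f g : f \in L2 -> g \in L2 -> dot f f = 0 -> dot f g = 0.
Proof.
move=> L2f L2g f0; have := cauchy_schwarz L2f L2g.
by rewrite f0 mul0r => h; apply/eqP; rewrite -sqrf_eq0 eq_le h sqr_ge0.
Qed.

(** * Projections onto finitely generated spaces *)

(** Recursion on the list makes orthogonalization an induction. *)
Fixpoint span (s : seq (T -> R)) : set (T -> R) :=
  if s is e :: s' then [set g | exists c, exists2 h, span s' h & g = c *: e + h]
  else [set 0].

Lemma span0 s : span s 0.
Proof. by elim: s => //= e s IH; exists 0, 0; rewrite // scale0r addr0. Qed.

Lemma spanD s f g : span s f -> span s g -> span s (f + g).
Proof.
elim: s f g => [|e s IH] f g /=; first by move=> -> ->; rewrite addr0.
move=> [a [f' sf ->]] [b [g' sg ->]]; exists (a + b), (f' + g').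
  exact: IH.
by rewrite scalerDl addrACA.
Qed.

Lemma spanZ s a f : span s f -> span s (a *: f).
Proof.
elim: s f => [|e s IH] f /=; first by move=> ->; rewrite scaler0.
move=> [b [f' sf ->]]; exists (a * b), (a *: f'); first exact: IH.
by rewrite scalerDr scalerA.
Qed.

Lemma span_sum s (I : Type) (t : seq I) (P : pred I) (F : I -> T -> R) :
  (forall i, P i -> span s (F i)) -> span s (\sum_(i <- t | P i) F i).
Proof.
by move=> sF; elim/big_ind: _ => //; [exact: span0 | exact: spanD].
Qed.

Lemma span_mem s e : List.In e s -> span s e.
Proof.
elim: s => //= e' s IH [->|/IH se]; first by exists 1, 0; rewrite ?scale1r ?addr0//; exact: span0.
by exists 0, e => //; rewrite scale0r add0r.
Qed.

Lemma span_ind (P : (T -> R) -> Prop) s : P 0 ->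
  (forall a e f, List.In e s -> P f -> P (a *: e + f)) ->
  forall f, span s f -> P f.
Proof.
elim: s => [|e s IH] P0 Ps f /=; first by move=> ->.
move=> [a [g sg ->]]; apply: (Ps); first by left.
by apply: IH => // b e1 f1 s1 Pf1; apply: (Ps) => //; right.
Qed.

Lemma span_L2 s : (forall e, List.In e s -> e \in L2) ->
  forall f, span s f -> f \in L2.
Proof.
move=> L2s; apply: span_ind; first exact: L2_0.
by move=> a e f /L2s L2e L2f; apply: L2D => //; exact: L2Z.
Qed.

(** Gram-Schmidt: the new generator is corrected by its projection onto the
    span of the others. If the corrected vector is null, then the
    coefficient is [0] (division by [0]), which is right by [dot_null]. *)
Lemma span_proj s : (forall e, List.In e s -> e \in L2) ->
  forall f, f \in L2 -> exists2 g, span s g &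
    forall h, span s h -> dot (f - g) h = 0.
Proof.
elim: s => [|e s IH] L2s f L2f.
  by exists 0 => // h ->; rewrite dot0r.
have L2e : e \in L2 by apply: L2s; left.
have {}L2s e' : List.In e' s -> e' \in L2 by move=> ?; apply: L2s; right.
have L2sp := span_L2 L2s.
have [g sg og] := IH L2s f L2f.
have [b sb ob] := IH L2s e L2e.
have [L2g L2b] : g \in L2 /\ b \in L2 by split; exact: L2sp.
have L2eb : e - b \in L2 by exact: L2B.
have L2fg : f - g \in L2 by exact: L2B.
pose c := dot (f - g) (e - b) / dot (e - b) (e - b).
exists (g + c *: (e - b)).
  exists c, (g + (- c) *: b); first by apply: spanD => //; exact: spanZ.
  by rewrite scalerBr scaleNr addrCA.
have L2c : c *: (e - b) \in L2 by exact: L2Z.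
have oc : dot (f - g - c *: (e - b)) (e - b) = 0.
  rewrite dotBl// dotZl//.
  have [eb0|eb0] := eqVneq (dot (e - b) (e - b)) 0; last first.
    by rewrite /c divfK// subrr.
  by rewrite eb0 mulr0 subr0 dotC dot_null.
have os h : span s h -> dot (f - g - c *: (e - b)) h = 0.
  move=> sh; rewrite dotBl ?dotZl//; [|exact: L2sp..].
  by rewrite og// ob// mulr0 subrr.
have L2r : f - g - c *: (e - b) \in L2 by exact: L2B.
move=> _ [a [h sh ->]]; rewrite opprD addrA.
have -> : a *: e + h = a *: (e - b) + (a *: b + h).
  by rewrite scalerBr addrA subrK.
have s2 : span s (a *: b + h) by apply: spanD => //; exact: spanZ.
rewrite dotDr ?dotZr ?oc ?os ?mulr0 ?addr0//; first exact: L2Z.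
exact: L2sp.
Qed.

End square_integrable.

(** * Cubes, their halves and slabs *)

Lemma measure_bigsetU_seq d (T : measurableType d) (R : realType)
    (mu : {measure set T -> \bar R}) (I : choiceType) (s : seq I)
    (F : I -> set T) : uniq s ->
  (forall i, i \in s -> measurable (F i)) ->
  (forall i j, i \in s -> j \in s -> F i `&` F j !=set0 -> i = j) ->
  (mu (\big[setU/set0]_(i <- s) F i) = \sum_(i <- s) mu (F i))%E.
Proof.
move=> us mF dF; rewrite -bigcup_seq measure_fin_bigcup//.
by rewrite -fsbig_seq.
Qed.

Lemma ltr_expn_div (R : realType) (a e : R) : 0 < e -> exists N, a < e * 2 ^+ N.
Proof.
move=> e0; have [N aN] : exists N, a / e < N%:R.
  by exists (Num.truncn (a / e)).+1; exact: truncnS_gt.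
exists N; rewrite -ltr_pdivrMl// mulrC; apply: (lt_trans aN).
by rewrite -natrX ltr_nat ltn_expl.
Qed.

Section cubes.
Context {R : realType} {n : nat}.
Implicit Types (P Q : cube R n) (x y : 'rV[R]_n) (i : 'I_n) (b : bool) (N : nat).

Lemma side_gt0 Q : 0 < side Q.
Proof. by rewrite /side. Qed.

Lemma corner_in Q : points Q Q.1.
Proof. by move=> i; rewrite lexx ltrDl side_gt0. Qed.

Lemma coord_measurable i :
  measurable_fun setT (fun x : euclid R n => (x : 'rV[R]_n) ord0 i).
Proof.
apply: (measurability _ (RGenOpens.measurableE R)) => //.
move=> _ [_ [a [b [-> <-]]]]; rewrite setTI; apply: sub_sigma_algebra => /=.
have /continuousP := @coord_continuous R 1 n ord0 i; apply.
exact: interval_open.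
Qed.

Lemma points_measurable Q : measurable (points Q).
Proof.
have -> : points Q = \bigcap_(i in [set: 'I_n])
    ((fun x : euclid R n => (x : 'rV[R]_n) ord0 i) @^-1`
      `[Q.1 ord0 i, Q.1 ord0 i + side Q[).
  apply/seteqP; split=> x.
    by move=> Qx i _ /=; rewrite in_itv/=; exact: Qx.
  by move=> Qx i; have /= := Qx i I; rewrite in_itv.
apply: fin_bigcap_measurable => // i _; rewrite -[X in measurable X]setTI.
exact: coord_measurable.
Qed.

Lemma sub_points P Q : points P `<=` points Q <->
  forall i, Q.1 ord0 i <= P.1 ord0 i /\
            P.1 ord0 i + side P <= Q.1 ord0 i + side Q.
Proof.
split=> [PQ i|PQ x Px i]; last first.
  have /andP[h1 h2] := Px i; have [h3 h4] := PQ i.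
  by rewrite (le_trans h3 h1) (lt_le_trans h2 h4).
have /(_ i)/andP[h1 h2] := PQ _ (corner_in P); split => //.
rewrite leNgt; apply/negP => h.
pose x : 'rV[R]_n := \row_j (if j == i then Q.1 ord0 i + side Q else P.1 ord0 j).
have /PQ/(_ i) : points P x.
  move=> j; rewrite mxE; case: eqVneq => [->|_]; last exact: corner_in.
  by rewrite h (ltW h2).
by rewrite mxE eqxx ltxx andbF.
Qed.

Definition half (e : {ffun 'I_n -> bool}) Q : cube R n :=
  (Q.1 + \row_i ((e i)%:R * (side Q / 2)), (Q.2%:num / 2)%:pos).

Lemma side_half e Q : side (half e Q) = side Q / 2.
Proof. by []. Qed.

Lemma halfP e Q x : points (half e Q) x <->
  points Q x /\ forall i, e i = (Q.1 ord0 i + side Q / 2 <= x ord0 i).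
Proof.
have s0 := side_gt0 Q.
split=> [Px|[Px ex] i].
  split=> i; have := Px i; rewrite side_half !mxE.
    by case: (e i) => /= /andP[h1 h2]; apply/andP; split; lra.
  case: (e i) => /= /andP[h1 h2]; apply/esym.
    by rewrite mul1r in h1.
  by apply/negbTE; rewrite -ltNge; lra.
have /andP[h1 h2] := Px i; rewrite side_half !mxE ex.
by case: (leP (Q.1 ord0 i + side Q / 2)) => /= h; apply/andP; split; lra.
Qed.

Lemma half_sub e Q : points (half e Q) `<=` points Q.
Proof. by move=> x /halfP[]. Qed.

Lemma half_cover Q x : points Q x -> exists e, points (half e Q) x.
Proof.
move=> Qx; exists [ffun i => Q.1 ord0 i + side Q / 2 <= x ord0 i].
by apply/halfP; split => // i; rewrite ffunE.
Qed.

Lemma half_inj e e' Q : points (half e Q) `&` points (half e' Q) !=set0 ->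
  e = e'.
Proof.
move=> [x [/halfP[_ h1] /halfP[_ h2]]]; apply/ffunP => i.
by rewrite h1 h2.
Qed.

(** Dyadic widths let a slab of a cube be covered by slabs of its halves, as
    in [slabS], so that masses are bounded by induction on [N]. *)
Definition slab b i N Q : set (euclid R n) := points Q `&`
  [set x : 'rV[R]_n | if b then Q.1 ord0 i + side Q - side Q / 2 ^+ N <= x ord0 i
                      else x ord0 i < Q.1 ord0 i + side Q / 2 ^+ N].

Lemma slab_measurable b i N Q : measurable (slab b i N Q).
Proof.
apply: measurableI; first exact: points_measurable.
have -> : [set x : 'rV[R]_n | if b
    then Q.1 ord0 i + side Q - side Q / 2 ^+ N <= x ord0 i
    else x ord0 i < Q.1 ord0 i + side Q / 2 ^+ N] =
  setT `&` (fun x : euclid R n => (x : 'rV[R]_n) ord0 i) @^-1` (if b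
    then `[Q.1 ord0 i + side Q - side Q / 2 ^+ N, +oo[
    else `]-oo, Q.1 ord0 i + side Q / 2 ^+ N[)%classic.
  rewrite setTI; apply/seteqP; split=> x /=;
    by case: b; rewrite /= in_itv/= ?andbT.
by apply: coord_measurable => //; case: b.
Qed.

Lemma slabS b i N Q x : slab b i N.+1 Q x ->
  exists2 e : {ffun 'I_n -> bool}, e i = b & slab b i N (half e Q) x.
Proof.
move=> [Qx]; have s0 := side_gt0 Q.
have [e ex] := half_cover Qx; have /halfP[_ /(_ i) ei] := ex.
have N1 : (1 <= 2 ^+ N :> R) by rewrite exprn_ege1// ler1n.
have N0 : (0 < 2 ^+ N :> R) by rewrite exprn_gt0.
have -> : side Q / 2 ^+ N.+1 = side Q / 2 / 2 ^+ N.
  by rewrite exprS invfM mulrA.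
have h : side Q / 2 / 2 ^+ N <= side Q / 2.
  by rewrite ler_pdivrMr// ler_peMr// divr_ge0// ltW.
move=> /= Hx; exists e.
  by rewrite ei; case: b Hx => Hx; [|apply/negbTE; rewrite -ltNge]; lra.
split=> //=; rewrite side_half !mxE.
have -> : e i = b.
  by rewrite ei; case: b Hx => Hx; [|apply/negbTE; rewrite -ltNge]; lra.
by case: b Hx => /= Hx; lra.
Qed.

End cubes.

(** * Doubling measures *)

Section doubling.
Context {R : realType} {n : nat}.
Variable mu : {measure set (euclid R n) -> \bar R}.
Implicit Types (P Q : cube R n) (x y : 'rV[R]_n) (i : 'I_n) (b : bool) (N : nat).
Implicit Types A B : set (euclid R n).

Definition double Q : cube R n := dilate 2%:pos%R Q.

(** The normalization [2 <= C] makes [rho] below positive. *)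
Definition doubling_by (C : R) := [/\ 2 <= C,
  forall Q, (mu (points Q) < +oo)%E &
  forall Q, (mu (points (double Q)) <= C%:E * mu (points Q))%E].

Lemma iter_dilate N Q :
  side (iter N double Q) = 2 ^+ N * side Q /\
  forall i, (iter N double Q).1 ord0 i = Q.1 ord0 i - (2 ^+ N - 1) / 2 * side Q.
Proof.
elim: N => [|N].
  by rewrite expr0 mul1r; split=> // i; rewrite subrr !mul0r subr0.
rewrite iterS; move: (iter N double Q) => S [IH1 IH2].
split=> [|i]; first by rewrite exprS -mulrA -IH1.
by rewrite !mxE IH2 IH1 /= exprS; field.
Qed.

(** A small cube has finite mass by local finiteness, and doubling it repeatedly
    covers any given cube with the same corner. *)
Lemma locally_finite_doubling : locally_finite mu -> doubling mu ->
  exists C, doubling_by C.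
Proof.
move=> lf [C0 dbl]; pose C := Num.max 2 C0.
have dblC Q : (mu (points (double Q)) <= C%:E * mu (points Q))%E.
  apply: (le_trans (dbl Q)); apply: lee_wpmul2r; first exact: measure_ge0.
  by rewrite lee_fin le_max lexx orbT.
exists C; split => // [|Q]; first by rewrite le_max lexx.
have [U [oU Ux Uoo]] := lf Q.1.
have /nbhs_ballP[e /= e0 eU] : nbhs (Q.1 : 'rV[R]_n) U by exact: open_nbhs_nbhs.
pose S : cube R n := (Q.1, PosNum e0).
have Soo : (mu (points S) < +oo)%E.
  apply: le_lt_trans Uoo; apply: le_measure; rewrite ?inE.
  - exact: points_measurable.
  - exact: sub_sigma_algebra.
  move=> y Sy; apply: eU; split => // i j; rewrite (ord1 i).
  have /andP[h1 h2] := Sy j; rewrite /ball/= ltr_distlC.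
  by rewrite /side/= in h1 h2; apply/andP; split; lra.
have Noo N : (mu (points (iter N double S)) < +oo)%E.
  elim: N => //= N IH; apply: (le_lt_trans (dblC _)).
  by rewrite lte_mul_pinfty// lee_fin le_max ler0n.
have [N sN] := ltr_expn_div (2 * side Q) e0.
apply: le_lt_trans (Noo N); apply: le_measure; rewrite ?inE;
  [exact: points_measurable..|].
have [h1 h2] := iter_dilate N S.
apply/sub_points => i; rewrite h1 h2 /S /side/= in sN *.
have N1 : (1 <= 2 ^+ N :> R) by rewrite exprn_ege1// ler1n.
have s0 : 0 < Q.2%:num by [].
split; last by lra.
by rewrite gerDl oppr_le0 mulr_ge0// ?divr_ge0 ?subr_ge0// ltW.
Qed.

Definition mass A : R := fine (mu A).

Variable C : R.
Hypothesis dblC : doubling_by C.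

Let fin_points Q : (mu (points Q) < +oo)%E. Proof. by case: dblC. Qed.

Lemma massE A : (mu A < +oo)%E -> mu A = (mass A)%:E.
Proof. by move=> Aoo; rewrite fineK// ge0_fin_numE. Qed.

Lemma mass_pointsE Q : mu (points Q) = (mass (points Q))%:E.
Proof. exact: massE. Qed.

Lemma le_measure_lty A B : measurable A -> measurable B -> A `<=` B ->
  (mu B < +oo)%E -> (mu A < +oo)%E.
Proof.
by move=> mA mB AB; apply: le_lt_trans; apply: le_measure; rewrite ?inE.
Qed.

Lemma le_mass A B : measurable A -> measurable B -> A `<=` B ->
  (mu B < +oo)%E -> mass A <= mass B.
Proof.
move=> mA mB AB Boo; have Aoo := le_measure_lty mA mB AB Boo.
by rewrite -lee_fin -!massE// le_measure ?inE.
Qed.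

Lemma le_mass_cover (I : choiceType) (s : seq I) (F : I -> set (euclid R n)) A :
  uniq s -> measurable A -> (forall j : I, j \in s -> measurable (F j)) ->
  (forall j : I, j \in s -> (mu (F j) < +oo)%E) ->
  (forall x, A x -> exists2 j : I, j \in s & F j x) ->
  mass A <= \sum_(j <- s) mass (F j).
Proof.
move=> us mA mF Foo AF.
have le : (mu A <= (\sum_(j <- s) mass (F j))%:E)%E.
  have -> : ((\sum_(j <- s) mass (F j))%:E = \sum_(j <- s) mu (F j))%E.
    by rewrite -sumEFin; apply: eq_big_seq => j sj; rewrite massE// Foo.
  by rewrite (fsbig_seq _ _ us); apply: content_sub_fsum.
by rewrite -lee_fin -massE//; apply: le_lt_trans le _; exact: ltry.
Qed.

Let C0 : 0 < C. Proof. by case: dblC => C2 _ _; apply: lt_le_trans C2. Qed.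

(** Since a half-size subcube carries at least the proportion [C ^- 2] of the mass
    of a cube, [rho] bounds the proportion of the rest. *)
Definition rho := 1 - C ^- 2.

Lemma rho_lt1 : rho < 1.
Proof. by rewrite /rho ltrBlDr ltrDl invr_gt0 exprn_gt0. Qed.

Lemma rho_gt0 : 0 < rho.
Proof.
case: dblC => C2 _ _; rewrite /rho subr_gt0 invf_lt1 ?exprn_gt0//.
by apply: lt_le_trans (_ : 2 ^+ 2 <= _); [rewrite -natrX ltr1n | rewrite ler_pXn2r ?nnegrE// ltW].
Qed.

(** Doubling [P] twice gives a cube that covers [Q]. *)
Lemma mass_sub P Q : points P `<=` points Q -> side P = side Q / 2 ->
  C ^- 2 * mass (points Q) <= mass (points P).
Proof.
case: (dblC) => _ _ dbl /sub_points PQ sP.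
have PP : points Q `<=` points (iter 2 double P).
  have [h1 h2] := iter_dilate 2 P.
  apply/sub_points => i; have [h3 h4] := PQ i; rewrite h1 h2 sP in h3 h4 *.
  have s0 := side_gt0 Q.
  by rewrite -natrX /=; split; lra.
rewrite mulrC ler_pdivrMr ?exprn_gt0// mulrC -lee_fin EFinM -!mass_pointsE.
apply: (@le_trans _ _ (mu (points (iter 2 double P)))).
  by apply: le_measure; rewrite ?inE//; exact: points_measurable.
apply: (le_trans (dbl _)); rewrite expr2 EFinM -muleA.
by apply: lee_wpmul2l => //; rewrite lee_fin ltW.
Qed.

Definition facing b i := [seq e : {ffun 'I_n -> bool} <- enum {ffun 'I_n -> bool} | e i == b].

Lemma facing_uniq b i : uniq (facing b i).
Proof. by rewrite filter_uniq// enum_uniq. Qed.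

(** The halves on the other side of the cube are disjoint from these, and one of
    them already carries the proportion [C ^- 2] of the mass. *)
Lemma mass_halves b i Q :
  \sum_(e <- facing b i)
     mass (points (half e Q)) <= rho * mass (points Q).
Proof.
(* any half on the side opposite to b *)
pose e0 : {ffun 'I_n -> bool} := [ffun=> ~~ b].
set s := facing b i.
have us : uniq (e0 :: s).
  rewrite /= facing_uniq andbT.
  by rewrite mem_filter ffunE; case: (b).
have : \sum_(e <- e0 :: s) mass (points (half e Q)) <= mass (points Q).
  rewrite -lee_fin -mass_pointsE -sumEFin.
  under eq_bigr => e _ do rewrite -mass_pointsE.
  rewrite -measure_bigsetU_seq//; last 2 first.
  - by move=> e _; exact: points_measurable.
  - by move=> e e' _ _; exact: half_inj.
  - apply: le_measure; rewrite ?inE.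
    + by apply: bigsetU_measurable => e _; exact: points_measurable.
    + exact: points_measurable.
    + by move=> x; rewrite -bigcup_seq => -[e _]; exact: half_sub.
have := mass_sub (@half_sub R n e0 Q) (side_half e0 Q).
by rewrite big_cons /rho mulrBl mul1r; lra.
Qed.

(** The mass of a slab decays geometrically: the half of a cube away from a
    face contains a fixed proportion of the mass, at every scale. *)
Lemma mass_slab b i N Q :
  mass (slab b i N Q) <= rho ^+ N * mass (points Q).
Proof.
have slab_oo M S : (mu (slab b i M S) < +oo)%E.
  apply: le_measure_lty (fin_points S); [exact: slab_measurable |
    exact: points_measurable | by move=> x []].
elim: N Q => [|N IH] Q.
  rewrite expr0 mul1r; apply: le_mass => //; [exact: slab_measurable |
    exact: points_measurable | by move=> x []].
apply: (@le_trans _ _ (\sum_(e <- facing b i) mass (slab b i N (half e Q)))).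
  apply: le_mass_cover => //.
  - exact: facing_uniq.
  - exact: slab_measurable.
  - by move=> e _; exact: slab_measurable.
  - move=> x /slabS[e eb ex]; exists e => //.
    by rewrite mem_filter eb eqxx mem_enum.
apply: (@le_trans _ _ (\sum_(e <- facing b i) rho ^+ N * mass (points (half e Q)))).
  exact: ler_sum.
rewrite -mulr_sumr exprSr -mulrA ler_wpM2l ?exprn_ge0 ?(ltW rho_gt0)//.
exact: mass_halves.
Qed.

Definition layer N Q := \big[setU/set0]_(k : bool * 'I_n) slab k.1 k.2 N Q.

Lemma layerP N Q x : layer N Q x <-> exists b i, slab b i N Q x.
Proof.
rewrite /layer -bigcup_seq; split=> [[[b i] _ h]|[b [i h]]].
  by exists b, i.
by exists (b, i) => //=; exact: mem_index_enum.
Qed.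

Lemma layer_measurable N Q : measurable (layer N Q).
Proof. by apply: bigsetU_measurable => k _; exact: slab_measurable. Qed.

Lemma mass_layer N Q :
  mass (layer N Q) <= (2 * n)%:R * rho ^+ N * mass (points Q).
Proof.
apply: (@le_trans _ _ (\sum_(k : bool * 'I_n) mass (slab k.1 k.2 N Q))).
  apply: le_mass_cover => //.
  - exact: index_enum_uniq.
  - exact: layer_measurable.
  - by move=> k _; exact: slab_measurable.
  - move=> k _; apply: le_measure_lty (fin_points Q); [exact: slab_measurable |
      exact: points_measurable | by move=> x []].
  - by move=> x /layerP[b [i h]]; exists (b, i); rewrite ?mem_index_enum.
apply: (@le_trans _ _ (\sum_(k : bool * 'I_n) rho ^+ N * mass (points Q))).
  by apply: ler_sum => k _; exact: mass_slab.
by rewrite sumr_const card_prod card_bool card_ord -mulrA mulr_natl.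
Qed.

Lemma subcube N Q z : points Q z -> exists S, [/\ points S z,
  points S `<=` points Q, side S = side Q / 2 ^+ N &
  C ^- 2 ^+ N * mass (points Q) <= mass (points S)].
Proof.
move=> Qz; elim: N => [|N [S [Sz SQ sS mS]]].
  by exists Q; split=> //; rewrite expr0 ?divr1 ?mul1r.
have [e ez] := half_cover Sz; exists (half e S); split => //.
- by apply: subset_trans SQ; exact: half_sub.
- by rewrite side_half sS exprSr invfM mulrA.
apply: le_trans (mass_sub (@half_sub _ _ e S) (side_half e S)).
rewrite exprS -mulrA ler_wpM2l// invr_ge0 exprn_ge0//; exact: ltW.
Qed.

End doubling.

(** * Polynomials on cubes *)

Lemma normr_horner_le (R : realType) (q : {poly R}) : exists2 L, 0 <= L &
  forall y z, 0 <= y <= 1 -> 0 <= z <= 1 ->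
    `|q.[y]| <= L /\ `|q.[y] - q.[z]| <= L * `|y - z|.
Proof.
elim/poly_ind: q => [|q c [L L0 IH]].
  by exists 0 => // y z _ _; rewrite !horner0 subrr normr0 mul0r.
exists (L *+ 2 + `|c|) => [|y z hy hz]; first by rewrite addr_ge0// mulrn_wge0.
have [h1 h2] := IH y z hy hz; have [h3 _] := IH z z hz hz.
have /andP[y0 y1] := hy; rewrite !hornerE; split.
  apply: (le_trans (ler_normD _ _)); rewrite lerD2r normrM (ger0_norm y0).
  apply: (le_trans (ler_piMr (normr_ge0 _) y1)).
  by rewrite mulr2n (le_trans h1)// lerDl.
have -> : q.[y] * y + c - (q.[z] * z + c) =
  (q.[y] - q.[z]) * y + q.[z] * (y - z) by ring.
apply: (le_trans (ler_normD _ _)); rewrite !normrM (ger0_norm y0).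
have h4 := ler_piMr (normr_ge0 (q.[y] - q.[z])) y1.
have h5 := ler_wpM2r (normr_ge0 (y - z)) h3.
have h6 : 0 <= `|c| * `|y - z| by rewrite mulr_ge0.
rewrite mulrDl mulr2n mulrDl; lra.
Qed.

Lemma prod_lipschitz (R : realType) (I : Type) (s : seq I) (a b : I -> R) L e :
  0 <= L -> (forall i, `|a i| <= L) -> (forall i, `|b i| <= L) ->
  (forall i, `|a i - b i| <= L * e) ->
  `|\prod_(i <- s) a i| <= L ^+ size s /\
  `|\prod_(i <- s) a i - \prod_(i <- s) b i| <= (size s)%:R * L ^+ size s * e.
Proof.
move=> L0 aL bL abe.
have bd (c : I -> R) t : (forall i, `|c i| <= L) ->
    `|\prod_(i <- t) c i| <= L ^+ size t.
  move=> cL; elim: t => [|i t IH]; first by rewrite big_nil normr1.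
  by rewrite big_cons normrM exprS ler_pM.
split; first exact: bd.
elim: s => [|i s IH]; first by rewrite !big_nil subrr normr0 !mul0r.
rewrite !big_cons; set A := \prod_(j <- s) a j; set B := \prod_(j <- s) b j.
have -> : a i * A - b i * B = a i * (A - B) + (a i - b i) * B by ring.
apply: (le_trans (ler_normD _ _)); rewrite !normrM.
have h1 : `|a i| * `|A - B| <= L * ((size s)%:R * L ^+ size s * e) by exact: ler_pM.
have h2 : `|a i - b i| * `|B| <= L * e * L ^+ size s by rewrite ler_pM// bd.
apply: (le_trans (lerD h1 h2)); rewrite le_eqVlt; apply/orP; left; apply/eqP.
by rewrite /= exprS -natr1; ring.
Qed.

Section polynomials.
Context {R : realType} {n : nat}.
Implicit Types (Q : cube R n) (x y z : 'rV[R]_n) (f : euclid R n -> R) (k : nat).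

Definition monomials k : seq (euclid R n -> R) :=
  [seq monomial (mpoly.bmnm b) | b <- enum {: mpoly.bmultinom n k}].

(** Defined as a span, so that [span_proj] provides projections and [span_ind]
    reduces linear statements to monomials. *)
Definition polyfun k : set (euclid R n -> R) := span (monomials k).

Lemma monomial_in k (b : mpoly.multinom n) : (mpoly.mdeg b < k)%N ->
  List.In (monomial b) (monomials k).
Proof.
move=> bk; pose b' := mpoly.BMultinom bk.
have : b' \in enum {: mpoly.bmultinom n k} by rewrite mem_enum.
rewrite /monomials; elim: (enum _) => //= c s IH; rewrite inE => /predU1P[<-|/IH].
  by left.
by right.
Qed.

Lemma in_monomials k f : List.In f (monomials k) ->
  exists2 b : mpoly.multinom n, (mpoly.mdeg b < k)%N & f = monomial b.
Proof.
rewrite /monomials; elim: (enum _) => //= c s IH [<-|/IH//].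
by exists (mpoly.bmnm c) => //; exact: mpoly.bmdeg.
Qed.

Lemma polyfunP k f : polyfun k f <->
  exists2 p : mpoly.mpoly n R, (mpoly.msize p <= k)%N &
    forall x, f x = mpoly.meval (x ord0) p.
Proof.
split=> [|[p pk fp]].
  move: f; apply: span_ind.
    by exists 0 => [|x]; rewrite ?mpoly.msize0 ?mpoly.meval0.
  move=> a e f /in_monomials[b bk ->] [p pk fp].
  exists (a *: mpoly.mpolyX R b + p).
    apply: leq_trans (mpoly.msizeD_le _ _) _; rewrite geq_max pk andbT.
    by apply: leq_trans (mpoly.msizeZ_le _ _) _; rewrite mpoly.msizeX.
  by move=> x; rewrite mpoly.mevalD mpoly.mevalZ mpoly.mevalX -fp.
have -> : f = \sum_(m <- mpoly.msupp p) mpoly.mcoeff m p *: monomial m.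
  apply/funext => x; rewrite fp mpoly.mevalE fct_sumE.
  by apply: eq_bigr.
rewrite big_seq_cond; apply: span_sum => m /andP[mp _]; apply: spanZ.
apply: span_mem; apply: monomial_in.
exact: leq_trans (mpoly.msize_mdeg_lt mp) pk.
Qed.

Lemma polyfun_measurable k f : polyfun k f -> measurable_fun setT f.
Proof.
move: f; apply: span_ind; first exact: measurable_cst.
move=> a e f /in_monomials[b bk ->] mf; apply: measurable_funD => //.
apply: measurable_funM; first exact: measurable_cst.
rewrite /monomial; elim: (index_enum _) => [|i s IH].
  by under eq_fun => x do rewrite big_nil; exact: measurable_cst.
under eq_fun => x do rewrite big_cons; apply: measurable_funM => //.
by apply: measurable_funX; exact: coord_measurable.
Qed.

Section interpolation.
Variable k : nat.
Hypothesis k0 : (0 < k)%N.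

Let t (r : nat) : R := r%:R / k%:R.

Let t_inj : injective t.
Proof.
move=> r s /(congr1 (fun u => u * k%:R)); rewrite /t !divfK ?pnatr_eq0 -?lt0n//.
by move=> /eqP; rewrite eqr_nat => /eqP.
Qed.

Let lag (r : 'I_k) : {poly R} := tnth (lagrange k t) r.

Definition node Q (e : {ffun 'I_n -> 'I_k}) : 'rV[R]_n :=
  \row_i (Q.1 ord0 i + side Q * t (e i)).

Lemma node_in Q e : points Q (node Q e).
Proof.
move=> i; rewrite mxE; have s0 := side_gt0 Q.
have k1 : (0 < k%:R :> R) by rewrite ltr0n.
have t0 : 0 <= t (e i) by rewrite divr_ge0.
have t1 : t (e i) < 1 by rewrite ltr_pdivrMr// mul1r ltr_nat.
by rewrite lerDl ltrD2l mulr_ge0 ?(ltW s0)//= gtr_pMr.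
Qed.

Let basis Q (e : {ffun 'I_n -> 'I_k}) x := \prod_i (lag (e i)).[(x ord0 i - Q.1 ord0 i) / side Q].

(** Tensor product Lagrange interpolation. By linearity and distributivity it
    suffices to reproduce the powers of each coordinate, which is interpolation
    in one variable of a power of an affine polynomial. *)
Lemma interpolation Q f x : polyfun k f ->
  f x = \sum_e f (node Q e) * basis Q e x.
Proof.
move: f; apply: span_ind; first by rewrite big1// => e _; rewrite mul0r.
move=> a e f /in_monomials[b bk ->] IH.
have -> : (a *: monomial b + f : euclid R n -> R) x = a * monomial b x + f x by [].
rewrite IH (_ : monomial b x = \sum_e monomial b (node Q e) * basis Q e x); last first.
  rewrite /monomial/basis.
  under [RHS]eq_bigr => e' _ do rewrite -big_split/=.
  under [RHS]eq_bigr => e' _ do under eq_bigr => i _ do rewrite mxE.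
  rewrite -(bigA_distr_bigA (fun i (r : 'I_k) => (Q.1 ord0 i + side Q * t r) ^+ b i *
     (lag r).[(x ord0 i - Q.1 ord0 i) / side Q])).
  apply: eq_bigr => i _.
  pose q : {poly R} := ((Q.1 ord0 i)%:P + (side Q)%:P * 'X) ^+ b i.
  have qk : (size q <= k)%N.
    apply: leq_trans (size_poly_exp_leq _ _) _.
    have s2 : (size ((Q.1 ord0 i)%:P + (side Q)%:P * 'X)%R <= 2)%N.
      apply: leq_trans (size_polyD _ _) _; rewrite geq_max.
      rewrite (leq_trans (size_polyC_leq1 _))//=.
      by rewrite mul_polyC (leq_trans (size_scale_leq _ _))// size_polyX.
    have bik : (b i < k)%N.
      by apply: leq_trans bk; rewrite ltnS mpoly.mdegE (bigD1 i)//= leq_addr.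
    apply: leq_trans bik; rewrite ltnS.
    by case: (size _) s2 => [|[|[|]]]//= _; rewrite ?mul0n ?mul1n.
  have qE (u : R) : q.[u] = (Q.1 ord0 i + side Q * u) ^+ b i.
    by rewrite /q horner_exp !hornerE.
  have xE : Q.1 ord0 i + side Q * ((x ord0 i - Q.1 ord0 i) / side Q) = x ord0 i.
    by field; rewrite gt_eqF// side_gt0.
  rewrite -{1}xE -qE {1}(lagrange_gen k0 t_inj qk) horner_sum.
  by apply: eq_bigr => r _; rewrite hornerM hornerC qE.
rewrite mulr_sumr -big_split/=; apply: eq_bigr => e' _.
by rewrite mulrA -mulrDl.
Qed.

(** In coordinates rescaled to the unit cube the interpolation basis does not
    depend on [Q]: it is bounded and Lipschitz. So [f] is bounded and Lipschitz in
    terms of its largest value [M] at the nodes, and cannot drop below [M / 2]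
    near the node where this value is attained. *)
Lemma polyfun_max : exists (K : R) (N : nat), 0 <= K /\
  forall Q f, polyfun k f -> exists (M : R) z, [/\ 0 <= M, points Q z,
    forall x, points Q x -> `|f x| <= K * M &
    forall x, points Q x ->
      (forall i, `|x ord0 i - z ord0 i| <= side Q / 2 ^+ N) -> M / 2 <= `|f x|].
Proof.
have [L L0 HL] : exists2 L, 0 <= L & forall r (u v : R), 0 <= u <= 1 -> 0 <= v <= 1 ->
    `|(lag r).[u]| <= L /\ `|(lag r).[u] - (lag r).[v]| <= L * `|u - v|.
  have /choice[F HF] r : exists L, 0 <= L /\
      forall (u v : R), 0 <= u <= 1 -> 0 <= v <= 1 ->
      `|(lag r).[u]| <= L /\ `|(lag r).[u] - (lag r).[v]| <= L * `|u - v|.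
    by have [L L0 HL] := normr_horner_le (lag r); exists L.
  exists (\sum_r F r) => [|r u v hu hv].
    by apply: sumr_ge0 => r _; have [] := HF r.
  have [F0 /(_ u v hu hv)[h1 h2]] := HF r.
  have Fr : F r <= \sum_r F r.
    rewrite (bigD1 r)//= lerDl; apply: sumr_ge0 => r' _.
    by have [] := HF r'.
  split; first exact: le_trans Fr.
  by apply: (le_trans h2); rewrite ler_wpM2r.
pose c : R := #|{ffun 'I_n -> 'I_k}|%:R.
have c0 : 0 <= c by [].
have [N HN] := @ltr_expn_div R (2 * c * (n%:R * L ^+ n)) 1 ltr01.
exists (c * L ^+ n), N; split; first by rewrite mulr_ge0// exprn_ge0.
move=> Q f pf; have s0 := side_gt0 Q.
pose g e := `|f (node Q e)|.
have [e0 e0max] : exists e0, forall e, g e <= g e0.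
  pose e1 : {ffun 'I_n -> 'I_k} := [ffun=> Ordinal k0].
  by have [e _ He] := @arg_maxP _ _ _ e1 xpredT g erefl; exists e => e'; exact: He.
have unit_coord x i : points Q x -> 0 <= (x ord0 i - Q.1 ord0 i) / side Q <= 1.
  move=> /(_ i)/andP[h1 h2]; rewrite divr_ge0 ?subr_ge0 ?(ltW s0)//=.
  by rewrite ler_pdivrMr// mul1r lerBlDl ltW.
have basis_le x e : points Q x -> `|basis Q e x| <= L ^+ n.
  move=> Qx; have := @prod_lipschitz _ _ (index_enum 'I_n)
    (fun i => (lag (e i)).[(x ord0 i - Q.1 ord0 i) / side Q])
    (fun i => (lag (e i)).[(x ord0 i - Q.1 ord0 i) / side Q]) L 0 L0.
  rewrite [size _](_ : _ = n); last by rewrite -sum1_size sum1_card card_ord.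
  case=> // i; try by have [] := HL (e i) _ _ (unit_coord _ i Qx) (unit_coord _ i Qx).
  by rewrite subrr normr0 mulr0.
have g0 : 0 <= g e0 by exact: normr_ge0.
exists (g e0), (node Q e0); split => //.
- exact: node_in.
- move=> x Qx; rewrite (interpolation Q x pf).
  apply: (le_trans (ler_norm_sum _ _ _)).
  apply: (@le_trans _ _ (\sum_(e : {ffun 'I_n -> 'I_k}) L ^+ n * g e0)).
    apply: ler_sum => e _; rewrite normrM mulrC ler_pM//; last exact: e0max.
    exact: basis_le.
  by rewrite sumr_const -mulrA mulr_natl.
move=> x Qx xz; set z := node Q e0 in xz *; have Qz : points Q z by exact: node_in.
have dle : `|f x - f z| <= c * (n%:R * L ^+ n * 2 ^- N) * g e0.
  rewrite (interpolation Q x pf) (interpolation Q z pf) -sumrB.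
  apply: (le_trans (ler_norm_sum _ _ _)).
  apply: (@le_trans _ _ (\sum_(e : {ffun 'I_n -> 'I_k})
      n%:R * L ^+ n * 2 ^- N * g e0)); last first.
    by rewrite [leLHS]sumr_const -[leLHS]mulr_natl -[leRHS]mulrA.
  apply: ler_sum => e _; rewrite -mulrBr normrM mulrC ler_pM//; last exact: e0max.
  have := @prod_lipschitz _ _ (index_enum 'I_n)
    (fun i => (lag (e i)).[(x ord0 i - Q.1 ord0 i) / side Q])
    (fun i => (lag (e i)).[(z ord0 i - Q.1 ord0 i) / side Q]) L (2 ^- N) L0.
  rewrite [size _](_ : _ = n); last by rewrite -sum1_size sum1_card card_ord.
  case=> // i; have [h1 h2] := HL (e i) _ _ (unit_coord _ i Qx) (unit_coord _ i Qz) => //.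
    by have [] := HL (e i) _ _ (unit_coord _ i Qz) (unit_coord _ i Qz).
  apply: (le_trans h2); apply: ler_wpM2l => //.
  rewrite -mulrBl opprB addrA subrK normrM [`|_^-1|]gtr0_norm ?invr_gt0//.
  by rewrite ler_pdivrMr// mulrC; exact: xz.
have small : c * (n%:R * L ^+ n * 2 ^- N) <= 1 / 2.
  have p0 : 0 < (2 ^+ N : R) by rewrite exprn_gt0.
  rewrite !mulrA ler_pdivrMr//; rewrite mul1r in HN; lra.
have h1 : c * (n%:R * L ^+ n * 2 ^- N) * g e0 <= 1 / 2 * g e0.
  by rewrite ler_wpM2r.
have h2 := lerB_dist (f z) (f x); rewrite distrC in h2.
have : `|f z| = g e0 by [].
lra.
Qed.

End interpolation.

End polynomials.

(** * Mass of polynomials for a doubling measure *)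

Section polynomial_mass.
Context {R : realType} {n : nat}.
Variable mu : {measure set (euclid R n) -> \bar R}.
Variable C : R.
Hypothesis dblC : doubling_by mu C.
Implicit Types (P Q : cube R n) (x y z : 'rV[R]_n) (f : euclid R n -> R).
Implicit Types A B : set (euclid R n).
Local Notation L2 := (Lfun mu 2%:E).
Local Notation mass := (mass mu).

Lemma indic_L2 A : measurable A -> (mu A < +oo)%E -> (\1_A : _ -> R) \in L2.
Proof.
move=> mA Aoo; apply: (@L2_bounded _ _ _ mu _ A 1) => //.
- by move=> x Ax; rewrite indicE mem_set// normr1.
- by move=> x nAx; rewrite indicE memNset.
Qed.

Lemma dot_indic A : measurable A -> dot mu \1_A \1_A = mass A.
Proof.
move=> mA; rewrite /dot/mass /Rintegral.
rewrite (_ : (fun x => _) = (fun x => (\1_A x)%:E)).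
  by rewrite integral_indic// setIT.
by apply/funext => x; rewrite indicE; case: (_ \in _); rewrite ?mulr1 ?mulr0.
Qed.

Lemma points_lty Q : (mu (points Q) < +oo)%E. Proof. by case: dblC. Qed.

Lemma sub_points_lty A Q : measurable A -> A `<=` points Q -> (mu A < +oo)%E.
Proof.
move=> mA AQ; apply: le_measure_lty AQ (points_lty Q) => //.
exact: points_measurable.
Qed.

Variable k : nat.
Hypothesis k0 : (0 < k)%N.

Lemma polyfun_L2 f A Q : polyfun k f -> measurable A -> A `<=` points Q ->
  f \* \1_A \in L2.
Proof.
move=> pf mA AQ; have [K [N [K0 H]]] := @polyfun_max R n k k0.
have [M [z [M0 _ fM _]]] := H Q f pf.
apply: (@L2_bounded _ _ _ mu _ A (K * M)) => //.
- exact: sub_points_lty AQ.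
- apply: measurable_funM; last exact: measurable_indic.
  exact: polyfun_measurable pf.
- by move=> x Ax /=; rewrite indicE mem_set// mulr1; exact/fM/AQ.
- by move=> x nAx /=; rewrite indicE memNset// mulr0.
Qed.

(** Used for small [r]: polynomials do not concentrate on parts of a cube of small
    mass. *)
Definition mass_spread K := 0 <= K /\ forall Q f A r, polyfun k f ->
  measurable A -> A `<=` points Q -> 0 <= r -> mass A <= r * mass (points Q) ->
  dot mu (f \* \1_A) (f \* \1_A) <=
    K * r * dot mu (f \* \1_(points Q)) (f \* \1_(points Q)).

(** If [M] is the largest value of [f] at the nodes, then [f] is at most a
    multiple of [M] on the part, and at least [M / 2] on a subcube whose size is
    a fixed fraction of that of [Q]; doubling bounds the mass of this subcube
    from below. *)
Lemma polyfun_mass : exists K, mass_spread K.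
Proof.
have [K [N [K0 H]]] := @polyfun_max R n k k0.
have C0 : 0 < C by case: dblC => C2 _ _; apply: lt_le_trans C2.
have e0 : 0 < (C ^- 2 ^+ N) by rewrite exprn_gt0// invr_gt0 exprn_gt0.
exists (K ^+ 2 * 4 / (C ^- 2 ^+ N)); split.
  by rewrite mulr_ge0 ?mulr_ge0 ?sqr_ge0// invr_ge0 ltW.
move=> Q f A r pf mA AQ r0 Ar.
have [M [z [M0 Qz fM Mf]]] := H Q f pf.
have [S [Sz SQ sS mS]] := subcube dblC N Qz.
have mpS := points_measurable S; have mpQ := points_measurable Q.
have L2cA (c : R) B : measurable B -> B `<=` points Q -> c *: (\1_B : _ -> R) \in L2.
  by move=> mB BQ; apply/L2Z/indic_L2 => //; exact: sub_points_lty BQ.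
have upper : dot mu (f \* \1_A) (f \* \1_A) <= (K * M) ^+ 2 * mass A.
  rewrite -dot_indic// (_ : _ * dot _ _ _ =
    dot mu ((K * M) *: (\1_A : _ -> R)) ((K * M) *: (\1_A : _ -> R))); last first.
    have ? := indic_L2 mA (sub_points_lty mA AQ).
    by rewrite dotZl// ?dotZr// ?L2Z// mulrA expr2.
  apply: le_dot; rewrite ?L2cA ?(polyfun_L2 pf mA AQ)// => x.
  rewrite /= -!expr2 -real_normK ?num_real// -[leRHS]real_normK ?num_real//.
  rewrite ler_pXn2r ?nnegrE// !normrM /=.
  rewrite indicE; have [Ax|nAx] := pselect (A x); last by rewrite memNset// normr0 !mulr0.
  rewrite mem_set// normr1 !mulr1 -normrM ger0_norm ?mulr_ge0//.
  exact/fM/AQ.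
have lower : (M / 2) ^+ 2 * mass (points S) <=
    dot mu (f \* \1_(points Q)) (f \* \1_(points Q)).
  rewrite -dot_indic// (_ : _ * dot _ _ _ =
    dot mu ((M / 2) *: (\1_(points S) : _ -> R)) ((M / 2) *: (\1_(points S) : _ -> R))); last first.
    have ? := indic_L2 mpS (points_lty S).
    by rewrite dotZl// ?dotZr// ?L2Z// mulrA expr2.
  apply: le_dot; rewrite ?L2cA ?(polyfun_L2 pf mpQ (@subset_refl _ _))// => x.
  rewrite /= -!expr2 -real_normK ?num_real// -[leRHS]real_normK ?num_real//.
  rewrite ler_pXn2r ?nnegrE// !normrM /=.
  rewrite !indicE; have [Sx|nSx] := pselect (points S x); last first.
    by rewrite (memNset nSx) normr0 !mulr0 mulr_ge0.
  rewrite !mem_set//; last exact: SQ.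
  rewrite normr1 !mulr1 -normrM ger0_norm ?divr_ge0//.
  apply: Mf; first exact: SQ.
  move=> i; rewrite -sS ler_distlC.
  have /andP[h1 h2] := Sx i; have /andP[h3 h4] := Sz i.
  by apply/andP; split; lra.
have le1 : M ^+ 2 * mass (points Q) <=
    4 / (C ^- 2 ^+ N) * dot mu (f \* \1_(points Q)) (f \* \1_(points Q)).
  rewrite [leRHS]mulrAC ler_pdivlMr//; apply: le_trans (ler_wpM2l _ lower) => //.
  have -> : 4 * ((M / 2) ^+ 2 * mass (points S)) = M ^+ 2 * mass (points S) by field.
  by rewrite -mulrA ler_wpM2l ?sqr_ge0// mulrC.
apply: (le_trans upper).
apply: (@le_trans _ _ ((K * M) ^+ 2 * (r * mass (points Q)))).
  by rewrite ler_wpM2l ?sqr_ge0.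
have -> : (K * M) ^+ 2 * (r * mass (points Q)) =
  K ^+ 2 * r * (M ^+ 2 * mass (points Q)) by ring.
apply: (le_trans (ler_wpM2l _ le1)); first by rewrite mulr_ge0 ?sqr_ge0.
by rewrite le_eqVlt; apply/orP; left; apply/eqP; ring.
Qed.

End polynomial_mass.

Section grids.
Context {R : realType} {n : nat}.
Hypothesis hn : (0 < n)%N.
Implicit Types (P Q : cube R n) (x y z : 'rV[R]_n).
Variable D : set (cube R n).
Hypothesis gD : dyadic_grid D.

Lemma sub_side P Q : points P `<=` points Q -> side P <= side Q.
Proof.
by move=> /sub_points/(_ (Ordinal hn))[h1 h2]; lra.
Qed.

Lemma grid_side Q : D Q -> exists j : int, side Q = 2 ^ j.
Proof. by case: gD => h _ _; exact: h. Qed.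

Lemma grid_at (j : int) x : exists Q, [/\ D Q, side Q = 2 ^ j & points Q x].
Proof. by case: gD => _ h _; have [Q [HQ _]] := h j x; exists Q. Qed.

Lemma grid_eq P Q x : D P -> D Q -> side P = side Q -> points P x ->
  points Q x -> P = Q.
Proof.
move=> DP DQ PQ Px Qx; have [j sQ] := grid_side DQ.
case: gD => _ /(_ j x)[S [_ uS]] _.
by rewrite -(uS P) ?(uS Q)//; split => //; rewrite PQ.
Qed.

Lemma grid_nested P Q x : D P -> D Q -> points P x -> points Q x ->
  side P <= side Q -> points P `<=` points Q.
Proof.
move=> DP DQ Px Qx sPQ; case: (gD) => _ _ /(_ P Q DP DQ)[PQ0|//|QP].
  have : (points P `&` points Q) x by [].
  by rewrite PQ0.
suff -> : P = Q by [].
by apply: (@grid_eq _ _ x) => //; apply/eqP; rewrite eq_le sPQ sub_side.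
Qed.

Lemma grid_lt P Q : D P -> D Q -> side P < side Q -> side P <= side Q / 2.
Proof.
move=> /grid_side[i ->] /grid_side[j ->].
rewrite ltr_eXz2l ?ltr1n// => ij.
rewrite -[leRHS]/(2 ^ j * 2 ^ (-1)) -expfzDr ?pnatr_eq0//.
by rewrite ler_eXz2l ?ltr1n// -lezD1 in ij *; lra.
Qed.

Lemma child_at Q x : D Q -> points Q x ->
  exists2 P, children D Q P & points P x.
Proof.
move=> DQ Qx; have [j sQ] := grid_side DQ.
have [P [DP sP Px]] := grid_at (j - 1) x; exists P => //.
have sPQ : side P = side Q / 2 by rewrite sP sQ expfzDr ?pnatr_eq0.
split => //; apply: grid_nested Px Qx _ => //.
by have := side_gt0 Q; rewrite sPQ; lra.
Qed.

Lemma child_inj Q P P' x : children D Q P -> children D Q P' ->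
  points P x -> points P' x -> P = P'.
Proof.
move=> [DP _ sP] [DP' _ sP'] Px P'x; apply: grid_eq Px P'x => //.
by rewrite sP sP'.
Qed.

Lemma child_over P Q x : D P -> D Q -> points P x -> points Q x ->
  side P < side Q -> exists2 Q', children D Q Q' & points P `<=` points Q'.
Proof.
move=> DP DQ Px Qx PQ; have [Q' chQ' Q'x] := child_at DQ Qx; exists Q' => //.
have [DQ' _ sQ'] := chQ'; apply: grid_nested Px Q'x _ => //.
by rewrite sQ' grid_lt.
Qed.

Lemma parent_of P : D P -> exists2 Q, D Q & children D Q P.
Proof.
move=> DP; have [j sP] := grid_side DP.
have [Q [DQ sQ Qx]] := grid_at (j + 1) P.1; exists Q => //.
have sPQ : side P = side Q / 2.
  by rewrite sP sQ expfzDr ?pnatr_eq0// mulfK ?pnatr_eq0.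
split => //; apply: grid_nested (corner_in P) Qx _ => //.
by have := side_gt0 Q; rewrite sPQ; lra.
Qed.

(** A cube of the grid of side [w] meeting [Q] contains a point of the lattice
    of mesh [w] through the corner of [Q], and it is determined by this point. *)
Lemma finite_meet Q (j : int) :
  finite_set [set P | [/\ D P, side P = 2 ^ j & points P `&` points Q !=set0]].
Proof.
pose w : R := 2 ^ j; have w0 : 0 < w by rewrite exprz_gt0.
have [N QN] := ltr_expn_div (side Q) w0.
pose pt (e : {ffun 'I_n -> 'I_(2 ^ N).+1}) : 'rV[R]_n :=
  \row_i (Q.1 ord0 i + w * (e i)%:R).
have /choice[F HF] e : exists P, [/\ D P, side P = 2 ^ j & points P (pt e)].
  exact: grid_at.
apply: (@sub_finite_set _ _ (range F)); last exact: finite_image.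
move=> P [DP sP [x [Px Qx]]].
have /choice[e He] i : exists b : 'I_(2 ^ N).+1,
    P.1 ord0 i <= Q.1 ord0 i + w * b%:R < P.1 ord0 i + w.
  have /andP[h1 h2] := Px i; have /andP[h3 h4] := Qx i.
  rewrite sP -/w in h2.
  have hN : P.1 ord0 i <= Q.1 ord0 i + w * (2 ^ N)%N%:R by rewrite natrX; lra.
  have ex : exists b : nat, P.1 ord0 i <= Q.1 ord0 i + w * b%:R by exists (2 ^ N)%N.
  case: (ex_minnP ex) => b hb bmin.
  have bN : (b < (2 ^ N).+1)%N by rewrite ltnS; exact: bmin.
  exists (Ordinal bN); rewrite hb /=.
  case: b hb bmin bN => [|b] hb bmin _; first by rewrite mulr0; lra.
  rewrite -natr1; have : ~~ (P.1 ord0 i <= Q.1 ord0 i + w * b%:R).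
    by apply/negP => /bmin; rewrite ltnn.
  by rewrite -ltNge; lra.
exists [ffun i => e i] => //; have [DF sF Fpt] := HF [ffun i => e i].
apply: grid_eq Fpt _ => //; first by rewrite sP sF.
by move=> i; rewrite !mxE ffunE sP; exact: He.
Qed.

Lemma children_finite Q : D Q -> finite_set (children D Q).
Proof.
move=> DQ; have [j sQ] := grid_side DQ.
apply: sub_finite_set (finite_meet Q (j - 1)) => P [DP PQ sP]; split => //.
  by rewrite sP sQ expfzDr ?pnatr_eq0.
by exists P.1; split; [|apply: PQ]; exact: corner_in.
Qed.

Lemma children_seq Q : D Q -> exists2 s : seq (cube R n), uniq s &
  forall P, (P \in s) <-> children D Q P.
Proof.
move=> /children_finite/finite_seqP[s sE]; exists (undup s).
  exact: undup_uniq.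
by move=> P; rewrite mem_undup sE.
Qed.

(** Another child is disjoint from [P] and carries the proportion [C ^- 2] of the
    mass of [Q]. *)
Lemma mass_child (mu : {measure set (euclid R n) -> \bar R}) (C : R) P Q :
  doubling_by mu C -> D Q -> children D Q P ->
  mass mu (points P) <= rho C * mass mu (points Q).
Proof.
move=> dbl DQ chP; have [DP PQ sP] := chP; have s0 := side_gt0 Q.
pose i0 := Ordinal hn.
have [x Qx nPx] : exists2 x, points Q x & ~ points P x.
  have [h|h] := ltP (Q.1 ord0 i0) (P.1 ord0 i0).
    exists Q.1; first exact: corner_in.
    by move=> /(_ i0); rewrite leNgt h.
  exists (Q.1 + \row_i (side Q / 2)).
    by move=> i; rewrite !mxE; apply/andP; split; lra.
  move=> /(_ i0); rewrite !mxE sP => /andP[h1 h2].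
  by lra.
have [P' chP' P'x] := child_at DQ Qx; have [DP' P'Q sP'] := chP'.
have disj : forall S S', S \in [:: P; P'] -> S' \in [:: P; P'] ->
    points S `&` points S' !=set0 -> S = S'.
  move=> S S'; rewrite !inE.
  have ch V : (V == P) || (V == P') -> children D Q V by move=> /orP[]/eqP->.
  by move=> /ch hS /ch hS' [y [Sy S'y]]; exact: child_inj hS hS' Sy S'y.
have PP' : P != P' by apply/eqP => PP'; apply: nPx; rewrite PP'.
have : mass mu (points P) + mass mu (points P') <= mass mu (points Q).
  rewrite -lee_fin EFinD -!(mass_pointsE dbl).
  have <- : mu (\big[setU/set0]_(S <- [:: P; P']) points S) =
      (mu (points P) + mu (points P'))%E.
    rewrite measure_bigsetU_seq ?big_cons ?big_nil ?adde0//.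
    - by rewrite /= inE PP'.
    - by move=> S _; exact: points_measurable.
  rewrite !big_cons big_nil setU0; apply: le_measure; rewrite ?inE.
  - by apply: measurableU; exact: points_measurable.
  - exact: points_measurable.
  - by rewrite subUset.
have := mass_sub dbl P'Q sP'.
by rewrite /rho mulrBl mul1r; lra.
Qed.

End grids.

(** * Alpert spaces *)

Section alpert_spaces.
Context {R : realType} {n : nat}.
Hypothesis hn : (0 < n)%N.
Variable mu : {measure set (euclid R n) -> \bar R}.
Variable C : R.
Hypothesis dblC : doubling_by mu C.
Variable k : nat.
Hypothesis k0 : (0 < k)%N.
Implicit Types (P Q : cube R n) (f g h : euclid R n -> R).
Local Notation L2 := (Lfun mu 2%:E).
Local Notation dot := (dot mu).

Lemma polyfun_points_L2 g Q : polyfun k g -> g \* \1_(points Q) \in L2.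
Proof.
by move=> pg; apply: (polyfun_L2 dblC k0 pg) (@subset_refl _ _); exact: points_measurable.
Qed.

Lemma sum_pieces (s : seq (cube R n)) f : uniq s ->
  (forall P P' x, P \in s -> P' \in s -> points P x -> points P' x -> P = P') ->
  (forall x, (forall P, P \in s -> ~ points P x) -> f x = 0) ->
  f = \sum_(P <- s) (f \* \1_(points P)).
Proof.
move=> us ds f0; apply/funext => x; rewrite fct_sumE /=.
have [[P Ps Px]|nx] := pselect (exists2 P, P \in s & points P x).
  rewrite (bigD1_seq P)//= indicE mem_set// mulr1 big_seq_cond big1 ?addr0//.
  move=> P' /andP[P's P'P]; rewrite indicE memNset ?mulr0// => P'x.
  by move: P'P; rewrite (ds P P' x)// eqxx.
rewrite f0; last by move=> P Ps Px; apply: nx; exists P.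
rewrite big_seq_cond big1// => P /andP[Ps _]; rewrite indicE memNset ?mulr0// => Px.
by apply: nx; exists P.
Qed.

Lemma polyfun_proj Q f : f \in L2 -> exists2 g, polyfun k g &
  forall h, polyfun k h -> dot (f - g \* \1_(points Q)) (h \* \1_(points Q)) = 0.
Proof.
move=> L2f; pose r := fun e : euclid R n -> R => (e \* \1_(points Q) : _ -> R).
pose s := map r (monomials k).
have spanP h : polyfun k h -> span s (r h).
  rewrite /polyfun /s; move: (monomials k) h; elim => [|e t IH] h /=.
    by move=> ->; apply/funext => x; rewrite /r/= mul0r.
  move=> [c [l tl ->]]; exists c, (r l); first exact: IH.
  by apply/funext => x; rewrite /r/= mulrDl -mulrA.
have spanE l : span s l -> exists2 h, polyfun k h & l = r h.
  rewrite /polyfun /s; move: (monomials k) l; elim => [|e t IH] l /=.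
    by move=> ->; exists 0 => //; apply/funext => x; rewrite /r/= mul0r.
  move=> [c [m /IH[h th ->] ->]]; exists (c *: e + h); first by exists c, h.
  by apply/funext => x; rewrite /r/= mulrDl -mulrA.
have L2s e : List.In e s -> e \in L2.
  have sp : forall e', List.In e' (monomials k) -> r e' \in L2.
    by move=> e' /span_mem pe'; exact: polyfun_points_L2.
  rewrite /s; elim: (monomials k) sp => //= e' t IH sp [<-|]; first by apply: sp; left.
  by apply: IH => e'' ?; apply: sp; right.
have [_ /spanE[g pg ->] og] := span_proj L2s L2f.
by exists g => // h /spanP; exact: og.
Qed.

Variable D : set (cube R n).
Hypothesis gD : dyadic_grid D.

(** The shape condition in the Alpert space, expressed child by child instead of
    by a choice of coefficients. *)
Definition pwpoly Q f :=
  (forall P, children D Q P ->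
     exists2 g, polyfun k g & forall x, points P x -> f x = g x) /\
  (forall x, ~ points Q x -> f x = 0).

Lemma pwpolyD Q f g : pwpoly Q f -> pwpoly Q g -> pwpoly Q (f + g).
Proof.
move=> [f1 f2] [g1 g2]; split=> [P chP|x nQx]; last first.
  by rewrite -[LHS]/(f x + g x) f2// g2// addr0.
have [f' pf ff'] := f1 P chP; have [g' pg gg'] := g1 P chP.
exists (f' + g') => [|x Px]; first exact: spanD.
by rewrite -[LHS]/(f x + g x) ff'// gg'.
Qed.

Lemma pwpolyZ Q a f : pwpoly Q f -> pwpoly Q (a *: f).
Proof.
move=> [f1 f2]; split=> [P chP|x nQx]; last first.
  by rewrite -[LHS]/(a * f x) f2// mulr0.
have [f' pf ff'] := f1 P chP.
exists (a *: f') => [|x Px]; first exact: spanZ.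
by rewrite -[LHS]/(a * f x) ff'.
Qed.

Lemma pwpolyB Q f g : pwpoly Q f -> pwpoly Q g -> pwpoly Q (f - g).
Proof. by move=> pf pg; rewrite -scaleN1r; apply: pwpolyD => //; exact: pwpolyZ. Qed.

Lemma pwpoly_points Q g : polyfun k g -> pwpoly Q (g \* \1_(points Q)).
Proof.
move=> pg; split=> [P [_ PQ _]|x nQx] /=; last by rewrite indicE memNset// mulr0.
by exists g => // x /PQ Qx; rewrite indicE mem_set// mulr1.
Qed.

Lemma pwpoly_child Q P g : D Q -> children D Q P -> polyfun k g ->
  pwpoly Q (g \* \1_(points P)).
Proof.
move=> DQ chP pg; have [_ PQ _] := chP; split=> [P' chP'|x nQx] /=; last first.
  by rewrite indicE memNset ?mulr0// => /PQ.
have [[x [P'x Px]]|PP'] := pselect (points P' `&` points P !=set0).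
  exists g => // y P'y; rewrite (child_inj gD chP chP' Px P'x) indicE mem_set//.
  by rewrite mulr1.
exists 0 => [|x P'x]; first exact: span0.
by rewrite indicE memNset ?mulr0// => Px; apply: PP'; exists x.
Qed.

Lemma pwpoly_sum Q f : D Q -> pwpoly Q f -> exists s : seq (cube R n),
  exists g : cube R n -> euclid R n -> R,
  [/\ uniq s, (forall P, (P \in s) <-> children D Q P),
    (forall P, P \in s -> polyfun k (g P)),
    (forall P, P \in s -> f \* \1_(points P) = g P \* \1_(points P)) &
    f = \sum_(P <- s) (f \* \1_(points P))].
Proof.
move=> DQ [f1 f2]; have [s us sch] := children_seq gD DQ.
have /choice[g Hg] P : exists g, P \in s -> polyfun k g /\
    forall x, points P x -> f x = g x.
  case: (boolP (P \in s)) => [/sch chP|_]; last by exists 0.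
  by have [g pg fg] := f1 P chP; exists g.
exists s, g; split => // [P Ps|P Ps|].
- by have [] := Hg P Ps.
- apply/funext => x /=; rewrite !indicE.
  have [Px|nPx] := pselect (points P x); last by rewrite memNset// !mulr0.
  by have [_ ->] := Hg P Ps.
apply: sum_pieces => // [P P' x /sch chP /sch chP'|x nx].
  exact: child_inj chP chP'.
apply: f2 => Qx; have [P chP Px] := child_at hn gD DQ Qx.
by apply: (nx P) => //; apply/sch.
Qed.

Lemma pwpoly_L2 Q f : D Q -> pwpoly Q f -> f \in L2.
Proof.
move=> DQ pf; have [s [g [_ _ pg fg ->]]] := pwpoly_sum DQ pf.
by apply: L2_sum => P Ps _; rewrite fg//; apply/polyfun_points_L2/pg.
Qed.

(** The children are disjoint, so that one projects on each child separately. *)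
Lemma pwpoly_proj Q f : D Q -> f \in L2 ->
  exists2 u, pwpoly Q u & forall v, pwpoly Q v -> dot (f - u) v = 0.
Proof.
move=> DQ L2f; have [s us sch] := children_seq gD DQ.
have /choice[g Hg] P : exists g, polyfun k g /\
    forall h, polyfun k h -> dot (f - g \* \1_(points P)) (h \* \1_(points P)) = 0.
  by have [g pg og] := polyfun_proj P L2f; exists g.
pose u := \sum_(P <- s) (g P \* \1_(points P)) : _ -> R.
have ps : forall t : seq _, {subset t <= s} ->
    pwpoly Q (\sum_(P <- t) (g P \* \1_(points P)) : _ -> R).
  elim=> [|P t IH] ts.
    rewrite big_nil; split=> // P _; exists 0 => //; exact: span0.
  rewrite big_cons; apply: pwpolyD; last by apply: IH => P' P't; apply: ts; rewrite inE P't orbT.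
  by apply: pwpoly_child => //; [apply/sch/ts; rewrite mem_head | have [] := Hg P].
have pu : pwpoly Q u by exact: ps.
exists u => // v pv; have L2u := pwpoly_L2 DQ pu.
have L2v := pwpoly_L2 DQ pv.
have L2fu : f - u \in L2 by exact: L2B.
have [s' [h [us' sch' ph vh ->]]] := pwpoly_sum DQ pv.
rewrite dot_sumr//; last by move=> P Ps _; rewrite vh//; apply/polyfun_points_L2/ph.
rewrite big_seq_cond big1// => P /andP[/[dup] Ps' /sch' chP _]; rewrite vh//.
have [pgP ogP] := Hg P; rewrite -[RHS](ogP (h P) (ph P Ps')).
apply: eq_dot => x /=; rewrite !indicE.
have [Px|nPx] := pselect (points P x); last by rewrite memNset// !mulr0.
rewrite mem_set// !mulr1; congr (_ * _).
rewrite -[LHS]/(f x - u x) -[RHS]/(f x - (g P \* \1_(points P)) x); congr (_ - _).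
have Ps : P \in s by apply/sch.
rewrite /u fct_sumE (bigD1_seq P)//= big_seq_cond big1 ?addr0// => P' /andP[P's P'P].
rewrite indicE memNset ?mulr0// => P'x; move: P'P.
by rewrite (child_inj gD (proj1 (sch P') P's) chP P'x Px) eqxx.
Qed.

(** At a given point at most one term of the sum over the children is nonzero,
    whence the local description; moments against monomials extend to
    polynomials by linearity. *)
Lemma alpert_spaceP Q f : D Q -> alpert_space mu D k Q f <->
  pwpoly Q f /\ forall g, polyfun k g -> dot f (g \* \1_(points Q)) = 0.
Proof.
move=> DQ.
have pieces (p : cube R n -> mpoly.mpoly n R) P (x : 'rV[R]_n) :
    children D Q P -> points P x ->
    \sum_(P \in children D Q) \1_(points P) x * mpoly.meval (x ord0) (p P) =
    mpoly.meval (x ord0) (p P).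
  move=> chP Px; rewrite -(fsbig_widen [set P]).
  - by rewrite fsbig_set1 indicE mem_set// mul1r.
  - by move=> _ ->.
  move=> P' [chP' /eqP P'P] /=; rewrite indicE memNset ?mul0r// => P'x.
  by move/eqP: P'P; apply; exact: (child_inj gD chP' chP P'x Px).
have pieces0 (p : cube R n -> mpoly.mpoly n R) (x : 'rV[R]_n) : ~ points Q x ->
    \sum_(P \in children D Q) \1_(points P) x * mpoly.meval (x ord0) (p P) = 0.
  move=> nQx; rewrite fsbig1// => P [_ PQ _]; rewrite indicE memNset ?mul0r//.
  by move=> /PQ.
have pwE : pwpoly Q f <-> exists p : cube R n -> mpoly.mpoly n R,
    (forall P, (mpoly.msize (p P) <= k)%N) /\
    f = fun x : 'rV[R]_n =>
      \sum_(P \in children D Q) \1_(points P) x * mpoly.meval (x ord0) (p P).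
  split=> [[f1 f2]|[p [pk ->]]]; last first.
    split=> [P chP|x nQx]; last exact: pieces0.
    exists (fun x : 'rV[R]_n => mpoly.meval (x ord0) (p P)).
      by apply/polyfunP; exists (p P).
    by move=> x Px; exact: pieces.
  have /choice[p Hp] P : exists p : mpoly.mpoly n R, (mpoly.msize p <= k)%N /\
      (children D Q P -> forall x : 'rV[R]_n, points P x -> f x = mpoly.meval (x ord0) p).
    have [chP|nchP] := pselect (children D Q P); last first.
      by exists 0; rewrite mpoly.msize0.
    have [g /polyfunP[p pk gp] fg] := f1 P chP.
    by exists p; split=> // _ x Px; rewrite fg.
  exists p; split=> [P|]; first by have [] := Hp P.
  apply/funext => x; have [Qx|nQx] := pselect (points Q x); last first.
    by rewrite pieces0// f2.
  have [P chP Px] := child_at hn gD DQ Qx.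
  by rewrite (pieces _ P)//; have [_ /(_ chP)->] := Hp P.
have momE b : pwpoly Q f -> (mpoly.mdeg b < k)%N ->
    (\int[mu]_(x in points Q) (f x * monomial b x)%:E =
     (dot f (monomial b \* \1_(points Q)))%:E)%E.
  move=> pf bk; rewrite integral_mkcond -dot_EFin; last 2 first.
  - exact: pwpoly_L2 pf.
  - by apply/polyfun_points_L2/span_mem/monomial_in.
  apply: eq_integral => x _; rewrite /patch /= indicE.
  by case: (x \in points Q); rewrite ?mulr1 ?mulr0.
split=> [[/pwE pf mom]|[pf mom]]; last first.
  split; first exact/pwE.
  by move=> b bk; rewrite momE// mom//; exact/span_mem/monomial_in.
have L2f := pwpoly_L2 DQ pf; split=> // g pg.
suff [] : polyfun k g /\ dot f (g \* \1_(points Q)) = 0 by [].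
move: g pg; apply: span_ind.
  split; first exact: span0.
  by apply: dot_eq0 => x /=; rewrite -[(0 : euclid R n -> R) x]/0 mul0r mulr0.
move=> a e g /[dup] e_in /in_monomials[b bk eE] [pg IH].
have pe : polyfun k e by exact: span_mem.
split; first by apply: spanD => //; exact: spanZ.
have -> : (a *: e + g) \* \1_(points Q) =
    a *: (e \* \1_(points Q) : _ -> R) + (g \* \1_(points Q)).
  by apply/funext => x /=; rewrite mulrDl -mulrA.
have [L2e L2g] := (polyfun_points_L2 Q pe, polyfun_points_L2 Q pg).
rewrite dotDr//; last exact: L2Z.
rewrite dotZr// IH addr0 eE; have := mom b bk; rewrite momE// => -[->].
by rewrite mulr0.
Qed.

(** The projection is the difference of the projections onto the piecewise
    polynomials and onto the polynomials on [Q]. *)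
Lemma alpert_proj_exists Q f : D Q -> f \in L2 ->
  exists g, is_alpert_proj mu D k Q f g.
Proof.
move=> DQ L2f; have [u pu ou] := pwpoly_proj DQ L2f.
have [q pq oq] := polyfun_proj Q L2f.
have pqQ := pwpoly_points Q pq.
have [L2u L2q] := (pwpoly_L2 DQ pu, pwpoly_L2 DQ pqQ).
set r : euclid R n -> R := q \* \1_(points Q) in pqQ L2q *.
have [L2fu L2fr] : f - u \in L2 /\ f - r \in L2 by split; exact: L2B.
have pur : pwpoly Q (u - r) by exact: pwpolyB.
have L2ur := pwpoly_L2 DQ pur.
exists (u - r); split.
  apply/alpert_spaceP => //; split=> // g pg.
  have L2g := polyfun_points_L2 Q pg.
  have -> : u - r = (f - r) - (f - u) by rewrite opprB [RHS]addrC addrA subrK.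
  by rewrite dotBl// oq// ou ?subrr//; exact: pwpoly_points.
move=> h /alpert_spaceP-/(_ DQ)[ph hh].
have L2h := pwpoly_L2 DQ ph.
have L2fur : f - (u - r) \in L2 by exact: L2B.
transitivity (dot (f - (u - r)) h)%:E; first exact: dot_EFin.
congr EFin.
have -> : f - (u - r) = (f - u) + r by rewrite opprB addrA addrAC.
by rewrite dotDl// ou// add0r dotC hh.
Qed.

Local Notation Delta := (alpert_proj mu D k).

Lemma alpert_projP Q f : D Q -> f \in L2 ->
  alpert_space mu D k Q (Delta Q f) /\
  forall h, alpert_space mu D k Q h -> dot (f - Delta Q f) h = 0.
Proof.
move=> DQ L2f; have [g Hg] := alpert_proj_exists DQ L2f.
have [h1 h2] : is_alpert_proj mu D k Q f (Delta Q f) by exact: (getPex (ex_intro _ g Hg)).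
split=> // h ah; have := h2 h ah.
have [pd _] := proj1 (alpert_spaceP _ DQ) h1.
have [ph _] := proj1 (alpert_spaceP _ DQ) ah.
have [L2d L2h] := (pwpoly_L2 DQ pd, pwpoly_L2 DQ ph).
have L2fd : f - Delta Q f \in L2 by exact: L2B.
move=> h0; apply: EFin_inj; exact: etrans (esym (dot_EFin L2fd L2h)) h0.
Qed.

Lemma alpert_L2 Q f : D Q -> alpert_space mu D k Q f -> f \in L2.
Proof. by move=> DQ /alpert_spaceP-/(_ DQ)[pf _]; exact: pwpoly_L2 pf. Qed.

Lemma Delta_L2 Q f : D Q -> f \in L2 -> Delta Q f \in L2.
Proof. by move=> DQ L2f; have [/(alpert_L2 DQ)] := alpert_projP DQ L2f. Qed.

Lemma dot_Delta Q f h : D Q -> f \in L2 -> alpert_space mu D k Q h ->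
  dot (Delta Q f) h = dot f h.
Proof.
move=> DQ L2f ah; have [_ /(_ h ah)] := alpert_projP DQ L2f.
rewrite dotBl ?Delta_L2//; last exact: alpert_L2 ah.
by move=> /eqP; rewrite subr_eq0 => /eqP.
Qed.

Lemma alpertD Q f g : D Q -> alpert_space mu D k Q f ->
  alpert_space mu D k Q g -> alpert_space mu D k Q (f + g).
Proof.
move=> DQ /[dup] af /alpert_spaceP-/(_ DQ)[pf mf] /[dup] ag /alpert_spaceP-/(_ DQ)[pg mg].
apply/alpert_spaceP => //; split; first exact: pwpolyD.
move=> h ph; have L2h := polyfun_points_L2 Q ph.
by rewrite dotDl ?mf ?mg ?addr0//; [exact: alpert_L2 af | exact: alpert_L2 ag].
Qed.

Lemma alpertZ Q a f : D Q -> alpert_space mu D k Q f ->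
  alpert_space mu D k Q (a *: f).
Proof.
move=> DQ /[dup] af /alpert_spaceP-/(_ DQ)[pf mf].
apply/alpert_spaceP => //; split; first exact: pwpolyZ.
move=> h ph; have L2h := polyfun_points_L2 Q ph.
by rewrite dotZl ?mf ?mulr0//; apply: alpert_L2 af.
Qed.

Lemma alpert0 Q : D Q -> alpert_space mu D k Q 0.
Proof.
move=> DQ; have [g [ag _]] := alpert_proj_exists DQ (L2_0 mu).
by rewrite -(scale0r g); exact: alpertZ.
Qed.

(** Outside [Q] the function [f] vanishes, and on [Q] its moments do. *)
Lemma alpert_poly_orth Q f g h : D Q -> alpert_space mu D k Q f ->
  polyfun k g -> (forall x, points Q x -> h x = g x) -> dot f h = 0.
Proof.
move=> DQ /alpert_spaceP-/(_ DQ)[[_ f0] mf] pg hg; rewrite -(mf g pg).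
apply: eq_dot => x /=; rewrite indicE; have [Qx|nQx] := pselect (points Q x).
  by rewrite hg// mem_set// mulr1.
by rewrite f0// !mul0r.
Qed.

Lemma alpert_off Q f x : D Q -> alpert_space mu D k Q f -> ~ points Q x -> f x = 0.
Proof. by move=> DQ /alpert_spaceP-/(_ DQ)[[_ f0] _]; exact: f0. Qed.

(** If the cubes meet, then the smaller one lies in a child of the larger one,
    where the Alpert function of the larger one is a polynomial. *)
Lemma alpert_orth P Q f g : D P -> D Q -> P != Q ->
  alpert_space mu D k P f -> alpert_space mu D k Q g -> dot f g = 0.
Proof.
have lt P' Q' f' g' x : D P' -> D Q' -> points P' x -> points Q' x ->
    side P' < side Q' -> alpert_space mu D k P' f' ->
    alpert_space mu D k Q' g' -> dot f' g' = 0.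
  move=> DP DQ Px Qx PQ af /alpert_spaceP-/(_ DQ)[[g1 _] _].
  have [S chS PS] := child_over hn gD DP DQ Px Qx PQ.
  have [h ph gh] := g1 S chS; apply: (alpert_poly_orth DP af ph) => y Py.
  exact/gh/PS.
move=> DP DQ PQ af ag.
have [[x [Px Qx]]|nPQ] := pselect (points P `&` points Q !=set0); last first.
  apply: dot_eq0 => x; have [Px|nPx] := pselect (points P x); last first.
    by rewrite (alpert_off DP af)// mul0r.
  rewrite (alpert_off DQ ag) ?mulr0// => Qx; apply: nPQ.
  by exists x.
have [sPQ|sQP|sPQ] := ltgtP (side P) (side Q).
- exact: (lt P Q f g x).
- by rewrite dotC; exact: (lt Q P g f x).
- by move/eqP: PQ; case; exact: (grid_eq gD DP DQ sPQ Px Qx).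
Qed.

Lemma alpert_pythagoras (s : seq (cube R n)) (F : cube R n -> euclid R n -> R) :
  uniq s -> (forall Q, Q \in s -> D Q /\ alpert_space mu D k Q (F Q)) ->
  dot (\sum_(Q <- s) F Q) (\sum_(Q <- s) F Q) = \sum_(Q <- s) dot (F Q) (F Q).
Proof.
move=> us sF; apply: pythagoras => //.
  by move=> Q /sF[DQ aQ]; exact: alpert_L2 aQ.
move=> P Q /sF[DP aP] /sF[DQ aQ] PQ.
exact: (alpert_orth DP DQ PQ aP aQ).
Qed.

End alpert_spaces.

(** * Almost orthogonality of distant scales *)

Lemma layer_cross (R : realType) (n : nat) (P Q : cube R n) (x : 'rV[R]_n) M :
  points P x -> points Q x -> ~ (points P `<=` points Q) ->
  side P <= side Q / 2 ^+ M -> layer M Q x.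
Proof.
move=> Px Qx nPQ sPQ; apply/layerP; apply/not_existsP => nslab.
apply/nPQ/sub_points => i.
have /andP[h1 h2] := Px i; have /andP[h3 h4] := Qx i.
have nf : ~ slab false i M Q x by move=> h; apply: (nslab false); exists i.
have nt : ~ slab true i M Q x by move=> h; apply: (nslab true); exists i.
split.
  rewrite leNgt; apply/negP => h; apply: nf; split=> //=; lra.
rewrite leNgt; apply/negP => h; apply: nt; split=> //=; lra.
Qed.

Section level_estimate.
Context {R : realType} {n : nat}.
Hypothesis hn : (0 < n)%N.
Variable mu : {measure set (euclid R n) -> \bar R}.
Variable C : R.
Hypothesis dblC : doubling_by mu C.
Variable k : nat.
Hypothesis k0 : (0 < k)%N.
Implicit Types (P Q : cube R n) (f g h : euclid R n -> R).
Implicit Types F G : seq (cube R n).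
Local Notation L2 := (Lfun mu 2%:E).
Local Notation dot := (dot mu).
Local Notation mass := (mass mu).
Local Notation rho := (rho C).

Variable K : R.
Hypothesis HK : mass_spread mu k K.

Let r0 M : 0 <= (2 * n)%:R * rho ^+ M.
Proof. by rewrite mulr_ge0// exprn_ge0// ltW// (rho_gt0 dblC). Qed.

(** Sum over the children the bound of [mass_spread] for a layer. *)
Lemma pwpoly_layer (E : set (cube R n)) Q f A M : dyadic_grid E -> E Q ->
  pwpoly k E Q f -> measurable A ->
  (forall P x, children E Q P -> A x -> points P x -> layer M P x) ->
  dot (f \* \1_A) (f \* \1_A) <= K * ((2 * n)%:R * rho ^+ M) * dot f f.
Proof.
move=> gE EQ pf mA Alayer.
have [s [g [us sch pg fg fE]]] := pwpoly_sum hn gE EQ pf.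
have disj P P' x : P \in s -> P' \in s -> points P x -> points P' x -> P = P'.
  by move=> /sch chP /sch chP'; exact: (child_inj gE chP chP').
have L2g P (B : set (euclid R n)) : P \in s -> measurable B -> B `<=` points P ->
    g P \* \1_B \in L2.
  by move=> Ps mB BP; exact: (polyfun_L2 dblC k0 (pg P Ps) mB BP).
have mAP P : measurable (A `&` points P).
  by apply: measurableI => //; exact: points_measurable.
have orth (B B' : set (euclid R n)) P P' : P \in s -> P' \in s -> P != P' ->
    B `<=` points P -> B' `<=` points P' -> dot (g P \* \1_B) (g P' \* \1_B') = 0.
  move=> Ps P's PP' BP BP'; apply: dot_eq0 => x /=; rewrite !indicE.
  have [Bx|nBx] := pselect (B x); last by rewrite (memNset nBx) !mulr0 mul0r.
  rewrite [x \in B']memNset ?mulr0// => B'x.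
  by move: PP'; rewrite (disj P P' x (Ps) P's (BP _ Bx) (BP' _ B'x)) eqxx.
have fAE : f \* \1_A = \sum_(P <- s) (g P \* \1_(A `&` points P)).
  apply/funext => x; rewrite fct_sumE /= {1}fE fct_sumE mulr_suml.
  apply: eq_big_seq => P Ps; rewrite fg//= indicI /= -mulrA; congr (_ * _).
  by rewrite mulrC.
have fE' : f = \sum_(P <- s) (g P \* \1_(points P)).
  by rewrite {1}fE; apply: eq_big_seq => P Ps; rewrite fg.
have [K0 HK2] := HK.
have pyth (B : cube R n -> set (euclid R n)) :
    (forall P, measurable (B P)) -> (forall P, B P `<=` points P) ->
    dot (\sum_(P <- s) (g P \* \1_(B P))) (\sum_(P <- s) (g P \* \1_(B P))) =
    \sum_(P <- s) dot (g P \* \1_(B P)) (g P \* \1_(B P)).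
  move=> mB BP; apply: pythagoras => // [P Ps|P P' Ps P's PP'].
    exact: L2g.
  exact: orth.
rewrite fAE [X in _ <= _ * dot X X]fE' (pyth _ mAP (fun P => @subIsetr _ _ _)).
rewrite (pyth points (@points_measurable R n) (fun P => @subset_refl _ _)).
rewrite mulr_sumr big_seq_cond [leRHS]big_seq_cond; apply: ler_sum => P.
rewrite andbT => Ps; apply: HK2 => //; first exact: pg.
apply: le_trans (mass_layer dblC M P); apply: le_mass => //.
- exact: layer_measurable.
- by move=> x [Ax Px]; apply: Alayer => //; exact/sch.
- apply: (sub_points_lty dblC (Q := P)); first exact: layer_measurable.
  by move=> x /layerP[b [i []]].
Qed.

(** An Alpert function of [D] whose cube lies in a child of some cube of [G] is
    orthogonal to the second sum, which is a polynomial on this child. The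
    remaining cubes of [F] cross the boundary of a child, hence lie in layers of
    relative width [2 ^- M], and [pwpoly_layer] applies to the Cauchy-Schwarz
    inequality on these layers. *)
Lemma level_estimate (D E : set (cube R n)) w M F G
    (phi psi : cube R n -> euclid R n -> R) :
  dyadic_grid D -> dyadic_grid E -> uniq F -> uniq G ->
  (forall Q, Q \in F -> [/\ D Q, side Q = w & alpert_space mu D k Q (phi Q)]) ->
  (forall P, P \in G -> [/\ E P, side P = w * 2 ^+ M.+1 &
     alpert_space mu E k P (psi P)]) ->
  dot (\sum_(Q <- F) phi Q) (\sum_(P <- G) psi P) ^+ 2 <=
    K * ((2 * n)%:R * rho ^+ M) *
    dot (\sum_(Q <- F) phi Q) (\sum_(Q <- F) phi Q) *
    dot (\sum_(P <- G) psi P) (\sum_(P <- G) psi P).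
Proof.
move=> gD gE uF uG HF HG.
set Phi := \sum_(Q <- F) phi Q; set Psi := \sum_(P <- G) psi P.
have L2phi Q : Q \in F -> phi Q \in L2.
  by move=> /HF[DQ _ aQ]; exact: (alpert_L2 hn dblC k0 gD DQ aQ).
have L2psi P : P \in G -> psi P \in L2.
  by move=> /HG[DQ _ aQ]; exact: (alpert_L2 hn dblC k0 gE DQ aQ).
have L2Psi : Psi \in L2 by apply: L2_sum => P PG _; exact: L2psi.
pose Fb := [seq Q <- F | dot (phi Q) Psi != 0].
have FbF Q : Q \in Fb -> Q \in F by rewrite mem_filter => /andP[].
have uFb : uniq Fb by rewrite filter_uniq.
pose A := \big[setU/set0]_(Q <- Fb) points Q.
have mA : measurable A by apply: bigsetU_measurable => Q _; exact: points_measurable.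
pose Phib := \sum_(Q <- Fb) phi Q.
have L2Phib : Phib \in L2 by apply: L2_sum => Q /FbF QF _; exact: L2phi.
have -> : dot Phi Psi = dot Phib (Psi \* \1_A).
  transitivity (dot Phib Psi).
    rewrite /Phi /Phib !dot_suml//; last 2 first.
    - by move=> Q /FbF QF _; exact: L2phi.
    - by move=> Q QF _; exact: L2phi.
    rewrite big_filter (bigID (fun Q => dot (phi Q) Psi != 0))/= [X in _ + X]big1 ?addr0//.
    by move=> Q; rewrite negbK => /eqP.
  apply: eq_dot => x /=; rewrite indicE.
  have [Ax|nAx] := pselect (A x); first by rewrite mem_set// mulr1.
  rewrite /Phib fct_sumE big_seq_cond big1 ?mul0r// => Q /andP[QFb _].
  have [DQ _ aQ] := HF Q (FbF Q QFb).
  apply: (alpert_off hn dblC k0 gD DQ aQ) => Qx; apply: nAx.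
  by rewrite /A -bigcup_seq; exists Q.
have L2PsiA : Psi \* \1_A \in L2 by exact: L2_indic.
apply: (le_trans (cauchy_schwarz L2Phib L2PsiA)).
have h1 : dot Phib Phib <= dot Phi Phi.
  rewrite /Phi /Phib !(alpert_pythagoras hn dblC k0 gD)//; last 2 first.
  - by move=> Q QF; have [] := HF Q QF.
  - by move=> Q /FbF QF; have [] := HF Q QF.
  rewrite big_filter [leRHS](bigID (fun Q => dot (phi Q) Psi != 0))/= lerDl.
  by apply: sumr_ge0 => Q _; exact: dot_ge0.
have psi_off P y : P \in G -> ~ points P y -> psi P y = 0.
  by move=> /HG[EP _ aP]; exact: (alpert_off hn dblC k0 gE EP aP).
have Gdisj P P' y : P \in G -> P' \in G -> points P y -> points P' y -> P = P'.
  move=> /HG[EP sP _] /HG[EP' sP' _] Py P'y.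
  by apply: (grid_eq gE EP EP' _ Py P'y); rewrite sP sP'.
have h2 : dot (Psi \* \1_A) (Psi \* \1_A) <=
    K * ((2 * n)%:R * rho ^+ M) * dot Psi Psi.
  have PsiAE : Psi \* \1_A = \sum_(P <- G) (psi P \* \1_A).
    by apply/funext => x; rewrite fct_sumE /= /Psi fct_sumE mulr_suml.
  have pyth (r : cube R n -> euclid R n -> R) : (forall P, P \in G -> r P \in L2) ->
      (forall P x, P \in G -> ~ points P x -> r P x = 0) ->
      dot (\sum_(P <- G) r P) (\sum_(P <- G) r P) = \sum_(P <- G) dot (r P) (r P).
    move=> L2r r_off; apply: pythagoras => // P P' PG P'G PP'.
    apply: dot_eq0 => x; have [Px|nPx] := pselect (points P x); last first.
      by rewrite r_off// mul0r.
    rewrite [r P' x]r_off ?mulr0// => P'x.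
    by move: PP'; rewrite (Gdisj P P' x)// eqxx.
  have L2A P : P \in G -> psi P \* \1_A \in L2.
    by move=> PG; apply: L2_indic => //; exact: L2psi.
  have offA P x : P \in G -> ~ points P x -> (psi P \* \1_A) x = 0.
    by move=> PG nPx /=; rewrite psi_off// mul0r.
  rewrite PsiAE (pyth _ L2A offA) /Psi (pyth _ L2psi psi_off).
  rewrite mulr_sumr big_seq_cond [leRHS]big_seq_cond; apply: ler_sum => P.
  rewrite andbT => PG; have [EP sP aP] := HG P PG.
  have [pP _] := proj1 (alpert_spaceP hn dblC k0 gE _ EP) aP.
  apply: (pwpoly_layer gE EP pP mA) => S x chS Ax Sx.
  move: Ax; rewrite /A -bigcup_seq => -[Q /= QFb Qx].
  have [DQ sQ aQ] := HF Q (FbF Q QFb).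
  have [_ SP sS] := chS.
  apply: (layer_cross Qx Sx); last first.
    rewrite sS sP sQ exprS; rewrite le_eqVlt; apply/orP; left; apply/eqP.
    by field; rewrite expf_neq0.
  move=> QS; move: QFb; rewrite mem_filter => /andP[/eqP + _]; apply.
  have [g pg psig] := (proj1 pP) S chS.
  apply: (alpert_poly_orth hn dblC k0 gD DQ aQ pg) => y Qy.
  have Sy := QS _ Qy.
  rewrite /Psi fct_sumE (bigD1_seq P)//= big_seq_cond big1 ?addr0 ?psig//.
  move=> P' /andP[P'G P'P]; apply: psi_off => // P'y.
  by move: P'P; rewrite (Gdisj P P' y PG P'G (SP _ Sy) P'y) eqxx.
apply: le_trans (ler_pM (dot_ge0 _ _) (dot_ge0 _ _) h1 h2) _.
by rewrite le_eqVlt; apply/orP; left; apply/eqP; ring.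
Qed.

End level_estimate.

(** * Completeness of the Alpert functions of a grid *)

Section completeness.
Context {R : realType} {n : nat}.
Hypothesis hn : (0 < n)%N.
Variable mu : {measure set (euclid R n) -> \bar R}.
Variable C : R.
Hypothesis dblC : doubling_by mu C.
Variable k : nat.
Hypothesis k0 : (0 < k)%N.
Implicit Types (P Q : cube R n) (f g h : euclid R n -> R).
Local Notation L2 := (Lfun mu 2%:E).
Local Notation dot := (dot mu).
Local Notation mass := (mass mu).
Local Notation rho := (rho C).
Variable K : R.
Hypothesis HK : mass_spread mu k K.
Variable E : set (cube R n).
Hypothesis gE : dyadic_grid E.

Lemma rho_small (a e : R) : 0 <= a -> 0 < e -> exists N, a * rho ^+ N <= e.
Proof.
move=> a0 e0; have r1 : `|rho| < 1.
  by rewrite gtr0_norm ?(rho_lt1 dblC)// (rho_gt0 dblC).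
have e1 : 0 < e / (a + 1) by rewrite divr_gt0// ltr_wpDl.
have /cvgrPdist_le/(_ _ e1)[N _ /(_ N (leqnn N))] := cvg_expr r1.
rewrite sub0r normrN ger0_norm ?exprn_ge0 ?(ltW (rho_gt0 dblC))// => h; exists N.
apply: (@le_trans _ _ ((a + 1) * rho ^+ N)).
  by rewrite ler_wpM2r ?lerDl// exprn_ge0// ltW// (rho_gt0 dblC).
by rewrite mulrC -ler_pdivlMr// ltr_wpDl.
Qed.

(** No disjointness or uniqueness of the cubes is recorded, which makes sums
    immediate; [alpert_sum_support] recovers a duplicate-free list of cubes. *)
Inductive alpert_sum : (euclid R n -> R) -> Prop :=
| alpert_sum0 : alpert_sum 0
| alpert_sumS P f g : E P -> alpert_space mu E k P f -> alpert_sum g ->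
    alpert_sum (f + g).

Lemma alpert_sumD f g : alpert_sum f -> alpert_sum g -> alpert_sum (f + g).
Proof.
elim=> [|P f' f'' EP af _ IH] sg; first by rewrite add0r.
by rewrite -addrA; apply: (alpert_sumS EP af); exact: IH.
Qed.

Lemma alpert_sum_L2 f : alpert_sum f -> f \in L2.
Proof.
elim=> [|P f' f'' EP af _ IH]; first exact: L2_0.
by apply: L2D => //; exact: (alpert_L2 hn dblC k0 gE EP af).
Qed.

Lemma alpert_sum_support g : alpert_sum g -> exists S : seq (cube R n),
  [/\ uniq S, (forall P, P \in S -> E P) & forall h, h \in L2 ->
    (forall P f, P \in S -> alpert_space mu E k P f -> dot h f = 0) ->
    dot h g = 0].
Proof.
elim=> [|P f' f'' EP af sf [S [uS SE oS]]].
  by exists [::]; split=> // h _ _; exact: dot0r.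
exists (undup (P :: S)); split; first exact: undup_uniq.
  by move=> Q; rewrite mem_undup inE => /predU1P[->//|/SE].
move=> h L2h oh; rewrite dotDr//; [|exact: (alpert_L2 hn dblC k0 gE EP af)|exact: alpert_sum_L2].
rewrite (oh P)// ?mem_undup ?mem_head// oS ?addr0// => Q f QS.
by apply: oh; rewrite mem_undup inE QS orbT.
Qed.

Definition alpert_closure f := f \in L2 /\
  forall e, 0 < e -> exists2 g, alpert_sum g & dot (f - g) (f - g) <= e.

Lemma alpert_closureP f : f \in L2 ->
  (forall e, 0 < e -> exists2 g, alpert_closure g & dot (f - g) (f - g) <= e) ->
  alpert_closure f.
Proof.
move=> L2f H; split=> // e e0.
have e4 : 0 < e / 4 by rewrite divr_gt0.
have [g [L2g Hg] fg] := H _ e4; have [h sh gh] := Hg _ e4.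
have L2h := alpert_sum_L2 sh.
exists h => //; have -> : f - h = (f - g) + (g - h) by rewrite addrA subrK.
have [L2fg L2gh] : f - g \in L2 /\ g - h \in L2 by split; exact: L2B.
apply: (le_trans (dot_sqrD L2fg L2gh (ltr01))); rewrite invr1; lra.
Qed.

Lemma alpert_closureD f g : alpert_closure f -> alpert_closure g ->
  alpert_closure (f + g).
Proof.
move=> [L2f Hf] [L2g Hg]; split; first exact: L2D.
move=> e e0; have e4 : 0 < e / 4 by rewrite divr_gt0.
have [f' sf ff'] := Hf _ e4; have [g' sg gg'] := Hg _ e4.
have [L2f' L2g'] := (alpert_sum_L2 sf, alpert_sum_L2 sg).
exists (f' + g'); first exact: alpert_sumD.
have -> : f + g - (f' + g') = (f - f') + (g - g') by rewrite opprD addrACA.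
have [L2ff L2gg] : f - f' \in L2 /\ g - g' \in L2 by split; exact: L2B.
apply: (le_trans (dot_sqrD L2ff L2gg (ltr01))); rewrite invr1; lra.
Qed.

Lemma alpert_closure0 : alpert_closure 0.
Proof.
split=> [|e e0]; first exact: L2_0.
by exists 0; [exact: alpert_sum0 | rewrite subrr dot0l ltW].
Qed.

Lemma alpert_closure_sum (I : eqType) (s : seq I) (F : I -> euclid R n -> R) :
  (forall i, i \in s -> alpert_closure (F i)) ->
  alpert_closure (\sum_(i <- s) F i).
Proof.
move=> sF; rewrite big_seq_cond; apply: big_ind; first exact: alpert_closure0.
  exact: alpert_closureD.
by move=> i /andP[/sF].
Qed.

(** By induction on [N]: the difference between a polynomial on a cube and its
    projection onto the polynomials on the parent is an Alpert function of the
    parent. So the polynomial on the [N]-th ancestor that remains is the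
    projection of the initial one. *)
Lemma climb P p N : E P -> polyfun k p -> exists Q q,
  [/\ E Q, points P `<=` points Q, mass (points P) <= rho ^+ N * mass (points Q),
    polyfun k q /\ alpert_sum (p \* \1_(points P) - q \* \1_(points Q)) &
    forall h, polyfun k h ->
      dot (p \* \1_(points P) - q \* \1_(points Q)) (h \* \1_(points Q)) = 0].
Proof.
move=> EP pp; elim: N => [|N [Q [q [EQ PQ mPQ [pq sq] oq]]]].
  exists P, p; rewrite expr0 mul1r subrr; split=> //.
    by split=> //; exact: alpert_sum0.
  by move=> h _; exact: dot0l.
have [Q' EQ' chQ] := parent_of hn gE EQ.
have [_ QQ' _] := chQ.
have L2p := polyfun_points_L2 dblC k0 P pp.
have L2q := polyfun_points_L2 dblC k0 Q pq.
have [q' pq' oq'] := polyfun_proj dblC k0 Q' L2q.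
have L2q' := polyfun_points_L2 dblC k0 Q' pq'.
set r : euclid R n -> R := p \* \1_(points P) in L2p sq oq *.
set s : euclid R n -> R := q \* \1_(points Q) in L2q sq oq oq'.
set t : euclid R n -> R := q' \* \1_(points Q') in L2q' oq' *.
have [L2rs L2st] : r - s \in L2 /\ s - t \in L2 by split; exact: L2B.
have rtE : r - t = (s - t) + (r - s) by rewrite [RHS]addrC addrA subrK.
exists Q', q'; split=> //; [exact: subset_trans QQ'| | |].
- apply: (le_trans mPQ); rewrite exprSr -mulrA ler_wpM2l//.
    by rewrite exprn_ge0// ltW// (rho_gt0 dblC).
  exact: (mass_child hn gE dblC EQ' chQ).
- split=> //; rewrite -/t rtE; apply: alpert_sumS sq; first exact: EQ'.
  apply/(alpert_spaceP hn dblC k0 gE _ EQ'); split.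
    by apply: pwpolyB; [exact: (pwpoly_child gE EQ' chQ) | exact: pwpoly_points].
  by move=> h ph; exact: oq'.
move=> h ph; have L2h := polyfun_points_L2 dblC k0 Q' ph.
rewrite -/t rtE dotDl// oq'// add0r -[RHS](oq h ph).
apply: eq_dot => x /=; rewrite !indicE.
have [Qx|nQx] := pselect (points Q x).
  by rewrite !mem_set//; exact: QQ'.
rewrite -[(r - s) x]/(r x - s x) /r /s /= !indicE [x \in points Q]memNset//.
by rewrite memNset ?mulr0 ?subrr ?mul0r// => /PQ.
Qed.

(** The remainder [s] on the [N]-th ancestor satisfies
    [|s|^2 = <r, s> <= |r| |s restricted to P|], and since [P] carries a proportion
    at most [rho ^+ N] of the mass of the ancestor, the last factor is a small
    multiple of [|s|]. *)
Lemma grid_poly_closure P p : E P -> polyfun k p ->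
  alpert_closure (p \* \1_(points P)).
Proof.
move=> EP pp; have L2p := polyfun_points_L2 dblC k0 P pp; split=> // e e0.
have [K0 HK2] := HK.
set r : euclid R n -> R := p \* \1_(points P) in L2p *.
have [N Ne] := rho_small (mulr_ge0 (dot_ge0 mu r) K0) e0.
have [Q [q [EQ PQ mPQ [pq sq] oq]]] := climb N EP pp.
have L2q := polyfun_points_L2 dblC k0 Q pq.
rewrite -/r in sq oq; set s : euclid R n -> R := q \* \1_(points Q) in L2q sq oq *.
exists (r - s) => //; rewrite opprB addrC subrK.
have mP := points_measurable P.
have L2sP : s \* \1_(points P) \in L2 by exact: L2_indic.
have e1 : dot s s = dot r (s \* \1_(points P)).
  have := oq q pq; rewrite -/s dotBl// => /eqP; rewrite subr_eq0 => /eqP <-.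
  apply: eq_dot => x; rewrite /r /= [\1_(points P) x]indicE.
  have [Px|nPx] := pselect (points P x); first by rewrite mem_set// !mulr1.
  by rewrite [x \in points P]memNset// !mulr0 mul0r.
have e2 : dot (s \* \1_(points P)) (s \* \1_(points P)) <= K * rho ^+ N * dot s s.
  have -> : s \* \1_(points P) = q \* \1_(points P).
    apply/funext => x; rewrite /s /= -mulrA; congr (_ * _); rewrite !indicE.
    have [Px|nPx] := pselect (points P x); last by rewrite [x \in points P]memNset// mulr0.
    by rewrite !mem_set ?mulr1//; exact: PQ.
  by apply: HK2 => //; rewrite exprn_ge0// ltW// (rho_gt0 dblC).
have := cauchy_schwarz L2p L2sP; rewrite -e1 => cs.
have {cs} cs : dot s s ^+ 2 <= (dot r r * K * rho ^+ N) * dot s s.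
  apply: (le_trans cs); rewrite -!mulrA ler_wpM2l ?dot_ge0//.
  by rewrite mulrA.
have [->|s0] := eqVneq (dot s s) 0; first exact: ltW.
have sp : 0 < dot s s by rewrite lt_def s0 dot_ge0.
by apply: le_trans Ne; rewrite expr2 ler_pM2r in cs.
Qed.

(** On an arbitrary cube, the grid cubes of a small size inside it leave only a
    thin layer along its boundary. *)
Lemma cube_poly_closure Q (j : int) p : side Q = 2 ^ j -> polyfun k p ->
  alpert_closure (p \* \1_(points Q)).
Proof.
move=> sQ pp; have L2p := polyfun_points_L2 dblC k0 Q pp.
have [K0 HK2] := HK.
set r : euclid R n -> R := p \* \1_(points Q) in L2p *.
apply: alpert_closureP => // e e0.
have [|N Ne] := @rho_small (K * (2 * n)%:R * dot r r) _ _ e0.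
  by rewrite !mulr_ge0 ?dot_ge0.
have := finite_meet gE Q (j - N%:Z) => /finite_seqP[s0 s0E].
pose s := [seq P <- undup s0 | `[< points P `<=` points Q >]].
have sP P : P \in s <-> [/\ E P, side P = 2 ^ (j - N%:Z) & points P `<=` points Q].
  rewrite mem_filter mem_undup; split.
    move=> /andP[/asboolP PQ Ps0].
    by have : [set` s0] P by []; rewrite -s0E => -[].
  move=> [EP sP PQ]; apply/andP; split; first exact/asboolP.
  suff : [set` s0] P by [].
  rewrite -s0E; split => //; exists P.1; split; [exact: corner_in|].
  exact/PQ/corner_in.
have us : uniq s by rewrite filter_uniq// undup_uniq.
have disj P P' x : P \in s -> P' \in s -> points P x -> points P' x -> P = P'.
  move=> /sP[EP sP1 _] /sP[EP' sP2 _] Px P'x.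
  by apply: (grid_eq gE EP EP' _ Px P'x); rewrite sP1.
exists (\sum_(P <- s) (p \* \1_(points P))).
  by apply: alpert_closure_sum => P /sP[EP _ _]; exact: grid_poly_closure.
pose U := \big[setU/set0]_(P <- s) points P.
have mU : measurable U by apply: bigsetU_measurable => P _; exact: points_measurable.
have UP x : U x <-> exists2 P, P \in s & points P x.
  by rewrite /U -bigcup_seq; split=> [[P Ps Px]|[P Ps Px]]; exists P.
pose A := points Q `\` U.
have mA : measurable A by apply: measurableD => //; exact: points_measurable.
have pUE : p \* \1_U = \sum_(P <- s) (p \* \1_(points P)).
  rewrite {1}(sum_pieces (s := s) (f := p \* \1_U))//; last first.
    by move=> x nx /=; rewrite indicE memNset ?mulr0// => /UP[P Ps]; exact: nx.
  apply: eq_big_seq => P Ps; apply/funext => x /=; rewrite -mulrA; congr (_ * _).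
  rewrite !indicE; have [Px|nPx] := pselect (points P x); last by rewrite (memNset nPx) mulr0.
  by rewrite !mem_set ?mulr1//; apply/UP; exists P.
have -> : r - \sum_(P <- s) (p \* \1_(points P)) = p \* \1_A.
  rewrite -pUE; apply/funext => x; rewrite -[LHS]/(r x - p x * \1_U x) /r /=.
  rewrite -mulrBr; congr (_ * _); rewrite !indicE.
  have [Ux|nUx] := pselect (U x).
    have Qx : points Q x by have /UP[P /sP[_ _ PQ] Px] := Ux; exact: PQ.
    rewrite [x \in points Q]mem_set// [x \in U]mem_set// subrr.
    by rewrite memNset// => -[].
  rewrite [x \in U]memNset// subr0; have [Qx|nQx] := pselect (points Q x).
    by rewrite !mem_set.
  by rewrite !memNset// => -[].
apply: (@le_trans _ _ (K * ((2 * n)%:R * rho ^+ N) * dot r r)); last first.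
  apply: le_trans Ne; rewrite le_eqVlt; apply/orP; left; apply/eqP; ring.
apply: HK2 => //.
- by move=> x [].
- by rewrite mulr_ge0// exprn_ge0// ltW// (rho_gt0 dblC).
apply: le_trans (mass_layer dblC N Q); apply: le_mass => //.
- exact: layer_measurable.
- move=> x [Qx nUx]; have [P [EP sP1 Px]] := grid_at gE (j - N%:Z) x.
  apply: (layer_cross Px Qx).
    by move=> PQ; apply: nUx; apply/UP; exists P => //; apply/sP.
  by rewrite sP1 sQ expfzDr ?pnatr_eq0// -exprnN.
apply: (sub_points_lty dblC (Q := Q)); first exact: layer_measurable.
by move=> x /layerP[b [i []]].
Qed.

Lemma alpert_in_closure (D : set (cube R n)) Q f : dyadic_grid D -> D Q ->
  alpert_space mu D k Q f -> alpert_closure f.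
Proof.
move=> gD DQ /(alpert_spaceP hn dblC k0 gD _ DQ)[pf _].
have [s [g [us sch pg fg ->]]] := pwpoly_sum hn gD DQ pf.
apply: alpert_closure_sum => P Ps; rewrite fg//.
have [DP _ _] := proj1 (sch P) Ps; have [j sP] := grid_side gD DP.
exact: cube_poly_closure sP (pg P Ps).
Qed.

Local Notation Delta := (alpert_proj mu E k).

(** The error of the expansion of [f] over [S] is orthogonal to the approximation
    of [phi] and is not longer than [f], so that the Cauchy-Schwarz inequality
    applies to it and to the error of the approximation. *)
Lemma alpert_complete f phi e : f \in L2 -> alpert_closure phi -> 0 < e ->
  exists S : seq (cube R n), [/\ uniq S, (forall P, P \in S -> E P) &
    `|dot f phi - \sum_(P <- S) dot (Delta P f) phi| <= e].
Proof.
move=> L2f [L2phi cphi] e0.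
have f1 : 0 < dot f f + 1 by rewrite ltr_wpDl ?dot_ge0.
have d0 : 0 < e ^+ 2 / (dot f f + 1) by rewrite divr_gt0 ?exprn_gt0.
have [g sg phig] := cphi _ d0.
have [S [uS SE oS]] := alpert_sum_support sg.
exists S; split=> //.
have L2D P : P \in S -> Delta P f \in L2.
  by move=> /SE EP; exact: (Delta_L2 hn dblC k0 gE EP L2f).
pose Sf := \sum_(P <- S) Delta P f.
have L2Sf : Sf \in L2 by apply: L2_sum => P PS _; exact: L2D.
have L2h : f - Sf \in L2 by exact: L2B.
have L2g := alpert_sum_L2 sg.
have oh P u : P \in S -> alpert_space mu E k P u -> dot (f - Sf) u = 0.
  move=> PS au; have EP := SE P PS; have L2u := alpert_L2 hn dblC k0 gE EP au.
  rewrite dotBl// /Sf dot_suml//; last by move=> Q QS _; exact: L2D.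
  rewrite (bigD1_seq P)//= big_seq_cond big1 ?addr0.
    by rewrite (dot_Delta hn dblC k0 gE)// subrr.
  move=> Q /andP[QS QP]; have EQ := SE Q QS.
  have [aQ _] := alpert_projP hn dblC k0 gE EQ L2f.
  exact: (alpert_orth hn dblC k0 gE EQ EP QP aQ au).
have -> : dot f phi - \sum_(P <- S) dot (Delta P f) phi = dot (f - Sf) (phi - g).
  rewrite [RHS]dotBr// oS// subr0 dotBl// /Sf dot_suml// => P PS _.
  exact: L2D.
have hh : dot (f - Sf) (f - Sf) = dot f (f - Sf).
  rewrite [LHS]dotBl// (dotC _ Sf) (_ : dot (f - Sf) Sf = 0) ?subr0//.
  rewrite /Sf dot_sumr//; last by move=> P PS _; exact: L2D.
  rewrite big_seq_cond big1// => P /andP[PS _]; apply: (oh P) => //.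
  by have [] := alpert_projP hn dblC k0 gE (SE P PS) L2f.
have hf : dot (f - Sf) (f - Sf) <= dot f f.
  have := cauchy_schwarz L2f L2h; rewrite -hh.
  have [->|h0] := eqVneq (dot (f - Sf) (f - Sf)) 0; first by rewrite dot_ge0.
  by rewrite expr2 ler_pM2r// lt_def h0 dot_ge0.
have L2pg : phi - g \in L2 by exact: L2B.
rewrite -(@ler_pXn2r _ 2)// ?nnegrE ?(ltW e0)// real_normK ?num_real//.
apply: (le_trans (cauchy_schwarz L2h L2pg)).
apply: (@le_trans _ _ ((dot f f + 1) * (e ^+ 2 / (dot f f + 1)))).
  by apply: ler_pM => //; rewrite ?dot_ge0// (le_trans hf)// lerDl.
by rewrite mulrC divfK// gt_eqF.
Qed.

End completeness.

(** * Comparison of the energies of two grids *)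

(** The distance [|i - j|]: one of the truncated differences vanishes. *)
Definition gap (i j : nat) := ((i - j) + (j - i))%N.

Lemma gapC i j : gap i j = gap j i.
Proof. exact: addnC. Qed.

Section schur.
Variable R : realType.
Variable q : R.
Hypotheses (q0 : 0 <= q) (q1 : q < 1).

Lemma sum_gap L (i : nat) : \sum_(j < L) q ^+ gap i j <= 2 / (1 - q).
Proof.
have q10 : 0 < 1 - q by rewrite subr_gt0.
have up M : (1 - q) * (\sum_(j < M | (i <= j)%N) q ^+ (j - i)) = 1 - q ^+ (M - i).
  elim: M => [|M IH]; first by rewrite big_ord0 mulr0 sub0n expr0 subrr.
  rewrite big_mkcond big_ord_recr -big_mkcond/= mulrDr IH.
  case: leqP => h; first by rewrite subSn// exprS; ring.
  by rewrite mulr0 addr0 (eqP (ltnW h : M - i == 0)%N) (eqP (h : M.+1 - i == 0)%N).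
have down M : (1 - q) * (\sum_(j < M | (j <= i)%N) q ^+ (i - j)) <= q ^+ (i.+1 - M).
  elim: M => [|M IH]; first by rewrite big_ord0 mulr0 exprn_ge0.
  rewrite big_mkcond big_ord_recr -big_mkcond/= mulrDr subSS.
  case: leqP => h.
    rewrite subSn// exprS in IH; apply: (le_trans (lerD IH (lexx _))).
    by rewrite le_eqVlt; apply/orP; left; apply/eqP; ring.
  move: IH; rewrite mulr0 addr0 (eqP (ltnW h : i - M == 0)%N).
  by rewrite (eqP (h : i.+1 - M == 0)%N).
rewrite ler_pdivlMr// mulrC.
have split_le : \sum_(j < L) q ^+ gap i j <=
    \sum_(j < L | (i <= j)%N) q ^+ (j - i) + \sum_(j < L | (j <= i)%N) q ^+ (i - j).
  rewrite [X in X + _]big_mkcond [X in _ + X]big_mkcond -big_split/=.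
  apply: ler_sum => j _; rewrite /gap.
  have [h|h|->] := ltngtP i j.
  - by rewrite (eqP (ltnW h : i - j == 0)%N) add0n addr0.
  - by rewrite (eqP (ltnW h : j - i == 0)%N) addn0 add0r.
  - by rewrite subnn addn0 expr0 lerDl.
apply: (le_trans (ler_wpM2l (ltW q10) split_le)); rewrite mulrDr up.
have h1 : q ^+ (i.+1 - L) <= 1 by rewrite exprn_ile1// ltW.
have h2 : 0 <= q ^+ (L - i) by rewrite exprn_ge0.
have := down L; lra.
Qed.

(** Schur's test for the kernel [q ^+ |i - j|]: apply the inequality between the
    arithmetic and geometric means to each product, and sum the kernel over rows
    and over columns. *)
Lemma schur_test L (x y : 'I_L -> R) (eta : R) : 0 < eta ->
  \sum_(i < L) \sum_(j < L) q ^+ gap i j * (x i * y j) <=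
  (1 - q)^-1 * (eta * \sum_i x i ^+ 2 + eta^-1 * \sum_j y j ^+ 2).
Proof.
move=> eta0.
have amgm a b : a * b <= (eta * a ^+ 2 + eta^-1 * b ^+ 2) / 2.
  rewrite -subr_ge0 (_ : _ - _ = eta^-1 / 2 * (eta * a - b) ^+ 2).
    by rewrite mulr_ge0 ?sqr_ge0// divr_ge0// invr_ge0 ltW.
  by field; rewrite gt_eqF.
apply: (@le_trans _ _ (\sum_(i < L) \sum_(j < L)
   (q ^+ gap i j * (eta / 2 * x i ^+ 2) + q ^+ gap i j * (eta^-1 / 2 * y j ^+ 2)))).
  apply: ler_sum => i _; apply: ler_sum => j _; rewrite -mulrDr.
  apply: ler_wpM2l; first exact: exprn_ge0.
  by apply: (le_trans (amgm _ _)); rewrite le_eqVlt; apply/orP; left; apply/eqP; ring.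
under eq_bigr => i _ do rewrite big_split/=.
rewrite big_split/= mulrDr; apply: lerD.
  under eq_bigr => i _ do rewrite -mulr_suml.
  apply: (@le_trans _ _ (\sum_(i < L) 2 / (1 - q) * (eta / 2 * x i ^+ 2))).
    apply: ler_sum => i _; apply: ler_wpM2r; last exact: sum_gap.
    by rewrite mulr_ge0 ?sqr_ge0// divr_ge0// ltW.
  rewrite -mulr_sumr -mulr_sumr le_eqVlt; apply/orP; left; apply/eqP.
  by field; rewrite gt_eqF// subr_gt0.
rewrite exchange_big/=; under eq_bigr => j _ do rewrite -mulr_suml.
apply: (@le_trans _ _ (\sum_(j < L) 2 / (1 - q) * (eta^-1 / 2 * y j ^+ 2))).
  apply: ler_sum => j _; apply: ler_wpM2r.
    by rewrite mulr_ge0 ?sqr_ge0// divr_ge0// invr_ge0 ltW.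
  by under eq_bigr => i _ do rewrite gapC; exact: sum_gap.
rewrite -mulr_sumr -mulr_sumr le_eqVlt; apply/orP; left; apply/eqP.
by field; rewrite !gt_eqF// subr_gt0.
Qed.

End schur.

(** Changing scale costs a factor [2 `^ |s|] per step, which for small [s] is
    compensated by the decay in [level_estimate]. *)
Lemma powR_scale (R : realType) (a s : R) (i j : nat) : 0 < a ->
  (a * 2 ^+ i) `^ (- s) <= (a * 2 ^+ j) `^ (- s) * (2 `^ `|s|) ^+ gap i j.
Proof.
move=> a0; pose tau : R := 2 `^ (- s); have t0 : 0 < tau by rewrite powR_gt0.
have tX m : 0 <= tau ^+ m by rewrite exprn_ge0// ltW.
have E m : (a * 2 ^+ m) `^ (- s) = a `^ (- s) * tau ^+ m.
  rewrite powRM ?ltW// ?exprn_gt0//; congr (_ * _).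
  by rewrite -powR_mulrn// -powRrM mulrC powRrM powR_mulrn// powR_ge0.
have T1 : tau <= 2 `^ `|s| 
  by apply: ler_powR; rewrite ?ler1n// ler_normr lexx orbT.
have T2 : 1 <= tau * 2 `^ `|s|.
  rewrite -powRD; last by rewrite pnatr_eq0 implybT.
  by rewrite -[leLHS](powRr0 2); apply: ler_powR; rewrite ?ler1n// addrC subr_ge0 ler_norm.
rewrite !E -mulrA ler_wpM2l ?powR_ge0// /gap.
have [ij|ji] := leqP i j.
  rewrite (eqP (ij : i - j == 0)%N) add0n -{1}(subnKC ij) exprD -mulrA -exprMn.
  by rewrite ler_peMr// exprn_ege1.
rewrite (eqP (ltnW ji : j - i == 0)%N) addn0 -{1}(subnKC (ltnW ji)) exprD.
by rewrite ler_wpM2l// lerXn2r ?nnegrE ?powR_ge0.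
Qed.

Lemma schur_term (R : realType) (w1 w2 A B c r t z : R) (g : nat) :
  0 <= w1 -> 0 <= A -> 0 <= B -> 0 <= c -> 0 <= r -> w1 <= w2 * t ^+ g ->
  z ^+ 2 <= c * r ^+ g * (A * B) ->
  w1 ^+ 2 * z <= Num.sqrt c * ((Num.sqrt r * t) ^+ g *
    (w1 * Num.sqrt A * (w2 * Num.sqrt B))).
Proof.
move=> w10 A0 B0 c0 r0 w12.
rewrite -(sqr_sqrtr A0) -(sqr_sqrtr B0) -(sqr_sqrtr c0) -(sqr_sqrtr r0).
rewrite !sqrtr_sqr !ger0_norm ?sqrtr_ge0//.
have := sqrtr_ge0 A; have := sqrtr_ge0 B; have := sqrtr_ge0 c; have := sqrtr_ge0 r.
move: (Num.sqrt A) (Num.sqrt B) (Num.sqrt c) (Num.sqrt r) => {A0 B0 c0 r0}al be {}c {}r.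
move=> r0 c0 be0 al0 zle; have rg0 : 0 <= r ^+ g by exact: exprn_ge0.
have b0 : 0 <= c * r ^+ g * (al * be) by rewrite !mulr_ge0.
have zb : z <= c * r ^+ g * (al * be).
  apply: (le_trans (ler_norm _)); rewrite -(@ler_pXn2r _ 2)// ?nnegrE//.
  rewrite real_normK ?num_real//; apply: (le_trans zle).
  rewrite [(r ^+ 2) ^+ g]exprAC le_eqVlt; apply/orP; left; apply/eqP; ring.
apply: (le_trans (ler_wpM2l (sqr_ge0 _) zb)).
rewrite exprMn.
have -> : c * (r ^+ g * t ^+ g * (w1 * al * (w2 * be))) =
  w1 * (c * r ^+ g * (al * be)) * (w2 * t ^+ g) by ring.
have -> : w1 ^+ 2 * (c * r ^+ g * (al * be)) = w1 * (c * r ^+ g * (al * be)) * w1.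
  by ring.
by apply: ler_wpM2l => //; exact: mulr_ge0.
Qed.

(** The weight in [schur_test] is chosen so that half of [X] is absorbed in the
    left-hand side. *)
Lemma absorb (R : realType) (c q X Y Z e : R) : 0 < c -> q < 1 ->
  Z <= c * ((1 - q)^-1 * ((1 - q) / (2 * c) * X + ((1 - q) / (2 * c))^-1 * Y)) ->
  `|X - Z| <= e / 2 -> X <= 4 * c ^+ 2 / (1 - q) ^+ 2 * Y + e.
Proof.
move=> c0 q1; have q10 : 0 < 1 - q by rewrite subr_gt0.
have -> : c * ((1 - q)^-1 * ((1 - q) / (2 * c) * X + ((1 - q) / (2 * c))^-1 * Y)) =
    X / 2 + 2 * c ^+ 2 / (1 - q) ^+ 2 * Y.
  by field; rewrite !gt_eqF.
have -> : 4 * c ^+ 2 / (1 - q) ^+ 2 * Y = 2 * (2 * c ^+ 2 / (1 - q) ^+ 2 * Y).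
  by field; rewrite gt_eqF.
move: (2 * c ^+ 2 / _ * Y) => W h1 h2; have := le_trans (ler_norm _) h2; lra.
Qed.

(** Scales are integers, but those of finitely many cubes are indexed by natural
    numbers after a common shift. *)
Lemma common_scale (R : realType) (n : nat) (s : seq (cube R n)) :
  (forall Q, Q \in s -> exists j : int, side Q = 2 ^ j) ->
  exists (a : R) (L : nat) (lev : cube R n -> 'I_L), 0 < a /\
    forall Q, Q \in s -> side Q = a * 2 ^+ lev Q.
Proof.
move=> H; have /choice[J HJ] Q : exists j : int, Q \in s -> side Q = 2 ^ j.
  by case: (boolP (Q \in s)) => [/H[j ?]|_]; [exists j | exists 0].
pose m := (\sum_(Q <- s) `|J Q|)%N.
have Jm Q : Q \in s -> (`|J Q| <= m)%N.
  by move=> Qs; rewrite /m (big_rem Q)//= leq_addr.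
exists (2 ^ (- m%:Z)), (m + m).+1, (fun Q => inord `|J Q + m%:Z|); split.
  by rewrite exprz_gt0.
move=> Q Qs; have JQ := Jm Q Qs; rewrite inordK; last first.
  by clear -JQ; lia.
rewrite HJ// exprnP -expfzDr ?pnatr_eq0//; congr (_ ^ _).
by clear -JQ; lia.
Qed.

Section main_inequality.
Context {R : realType} {n : nat}.
Hypothesis hn : (0 < n)%N.
Variable mu : {measure set (euclid R n) -> \bar R}.
Variable C : R.
Hypothesis dblC : doubling_by mu C.
Variable k : nat.
Hypothesis k0 : (0 < k)%N.
Implicit Types (P Q : cube R n) (f g h : euclid R n -> R).
Implicit Types D E : set (cube R n).
Implicit Types F G : seq (cube R n).
Local Notation L2 := (Lfun mu 2%:E).
Local Notation dot := (dot mu).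
Local Notation rho := (rho C).
Variable K : R.
Hypothesis HK : mass_spread mu k K.

Let rho0 : 0 < rho := rho_gt0 dblC.

Definition level_const : R := Num.max 1 (K * (2 * n)%:R / rho).

Let level_const1 : 1 <= level_const. Proof. by rewrite le_max lexx. Qed.

(** The adjacent and distant scales of [level_estimate] in either order, and the
    Cauchy-Schwarz inequality for equal scales. *)
Lemma level_bound D E (a : R) (i j : nat) F G (phi psi : cube R n -> euclid R n -> R) :
  dyadic_grid D -> dyadic_grid E -> uniq F -> uniq G ->
  (forall Q, Q \in F -> [/\ D Q, side Q = a * 2 ^+ i & alpert_space mu D k Q (phi Q)]) ->
  (forall P, P \in G -> [/\ E P, side P = a * 2 ^+ j & alpert_space mu E k P (psi P)]) ->
  dot (\sum_(Q <- F) phi Q) (\sum_(P <- G) psi P) ^+ 2 <=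
    level_const * rho ^+ gap i j *
    (dot (\sum_(Q <- F) phi Q) (\sum_(Q <- F) phi Q) *
     dot (\sum_(P <- G) psi P) (\sum_(P <- G) psi P)).
Proof.
have lt D' E' i' j' F' G' (u v : cube R n -> euclid R n -> R) : (i' < j')%N ->
  dyadic_grid D' -> dyadic_grid E' -> uniq F' -> uniq G' ->
  (forall Q, Q \in F' -> [/\ D' Q, side Q = a * 2 ^+ i' & alpert_space mu D' k Q (u Q)]) ->
  (forall P, P \in G' -> [/\ E' P, side P = a * 2 ^+ j' & alpert_space mu E' k P (v P)]) ->
  dot (\sum_(Q <- F') u Q) (\sum_(P <- G') v P) ^+ 2 <=
    level_const * rho ^+ gap i' j' *
    (dot (\sum_(Q <- F') u Q) (\sum_(Q <- F') u Q) *
     dot (\sum_(P <- G') v P) (\sum_(P <- G') v P)).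
  move=> ij gD gE uF uG HF HG.
  have HG' P : P \in G' -> [/\ E' P, side P = (a * 2 ^+ i') * 2 ^+ (j' - i'.+1).+1 &
      alpert_space mu E' k P (v P)].
    by move=> /HG[EP sP aP]; split=> //; rewrite sP -mulrA -exprD subnSK// subnKC// ltnW.
  apply: (le_trans (level_estimate hn dblC k0 HK gD gE uF uG HF HG')).
  rewrite -[leLHS]mulrA; apply: ler_wpM2r; first by rewrite mulr_ge0// dot_ge0.
  apply: (@le_trans _ _ ((K * (2 * n)%:R / rho) * rho ^+ gap i' j')).
    rewrite /gap (eqP (ltnW ij : i' - j' == 0)%N) add0n -(subnSK ij) exprS.
    by rewrite le_eqVlt; apply/orP; left; apply/eqP; field; rewrite gt_eqF.
  by apply: ler_wpM2r; [rewrite exprn_ge0// ltW | rewrite le_max lexx orbT].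
move=> gD gE uF uG HF HG; have [ij|ji|ij] := ltngtP i j.
- exact: (lt D E).
- rewrite dotC gapC [X in _ * X]mulrC; exact: (lt E D).
have L2F : \sum_(Q <- F) phi Q \in L2.
  by apply: L2_sum => Q /HF[DQ _ aQ] _; exact: (alpert_L2 hn dblC k0 gD DQ aQ).
have L2G : \sum_(Q <- G) psi Q \in L2.
  by apply: L2_sum => Q /HG[DQ _ aQ] _; exact: (alpert_L2 hn dblC k0 gE DQ aQ).
apply: (le_trans (cauchy_schwarz L2F L2G)).
by rewrite /gap ij subnn expr0 mulr1 ler_peMl// mulr_ge0// dot_ge0.
Qed.

(** The square root of the weight in the Sobolev norm. *)
Definition weight (s : R) Q : R := side Q `^ (- s).

Definition energy D s f F : R :=
  \sum_(Q <- F) weight s Q ^+ 2 *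
    dot (alpert_proj mu D k Q f) (alpert_proj mu D k Q f).

Lemma sum_levels (L : nat) (lev : cube R n -> 'I_L) F (u : cube R n -> R) :
  \sum_(Q <- F) u Q = \sum_(i < L) \sum_(Q <- [seq Q <- F | lev Q == i]) u Q.
Proof.
rewrite (partition_big lev xpredT)//=; apply: eq_bigr => i _.
by rewrite big_filter.
Qed.

(** Duality. The energy for [D] is the inner product of [f] with the sum of its
    weighted projections, and expanding along the projections for [E] gives a sum
    over pairs of scales whose terms decay geometrically by [level_bound].
    Schur's test bounds it by half of the energy for [D] plus a multiple of the
    energy for [E]. *)
Lemma energy_le D E s f F e : dyadic_grid D -> dyadic_grid E -> f \in L2 ->
  uniq F -> (forall Q, Q \in F -> D Q) -> 0 < e ->
  let q := Num.sqrt rho * 2 `^ `|s| in q < 1 ->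
  exists G, [/\ uniq G, (forall P, P \in G -> E P) &
    energy D s f F <= 4 * level_const / (1 - q) ^+ 2 * energy E s f G + e].
Proof.
move=> gD gE L2f uF FD e0 q q1.
pose u Q := alpert_proj mu D k Q f; pose v P := alpert_proj mu E k P f.
have au Q : D Q -> alpert_space mu D k Q (u Q).
  by move=> DQ; have [] := alpert_projP hn dblC k0 gD DQ L2f.
have av P : E P -> alpert_space mu E k P (v P).
  by move=> EP; have [] := alpert_projP hn dblC k0 gE EP L2f.
have L2u Q : Q \in F -> u Q \in L2.
  by move=> QF; exact: (Delta_L2 hn dblC k0 gD (FD Q QF) L2f).
pose Phi := \sum_(Q <- F) (weight s Q ^+ 2 *: u Q).
have cPhi : alpert_closure mu k E Phi.
  apply: (alpert_closure_sum hn dblC k0 gE) => Q QF.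
  apply: (alpert_in_closure hn dblC k0 HK gE gD (FD Q QF)).
  by apply: (alpertZ hn dblC k0 gD); [exact: FD | exact/au/FD].
have e2 : 0 < e / 2 by rewrite divr_gt0.
have [G [uG GE HG]] := alpert_complete hn dblC k0 gE L2f cPhi e2.
exists G; split=> //.
have L2v P : P \in G -> v P \in L2.
  by move=> PG; exact: (Delta_L2 hn dblC k0 gE (GE P PG) L2f).
have XE : dot f Phi = energy D s f F.
  rewrite /Phi dot_sumr//; last by move=> Q QF _; apply: L2Z; exact: L2u.
  apply: eq_big_seq => Q QF; rewrite dotZr//; last exact: L2u.
  by rewrite -(dot_Delta hn dblC k0 gD (FD Q QF) L2f (au Q (FD Q QF))).
have [a [L [lev [a0 Hlev]]]] : exists (a : R) (L : nat) (lev : cube R n -> 'I_L),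
    0 < a /\ forall Q, Q \in F ++ G -> side Q = a * 2 ^+ lev Q.
  apply: common_scale => Q; rewrite mem_cat => /orP[/FD DQ|/GE EQ].
    exact: (grid_side gD DQ).
  exact: (grid_side gE EQ).
pose w (i : 'I_L) : R := (a * 2 ^+ i) `^ (- s).
have w0 i : 0 <= w i by exact: powR_ge0.
pose Fi i := [seq Q <- F | lev Q == i]; pose Gj j := [seq P <- G | lev P == j].
have HFi i Q : Q \in Fi i -> [/\ D Q, side Q = a * 2 ^+ i & alpert_space mu D k Q (u Q)].
  rewrite mem_filter => /andP[/eqP <- QF]; split; [exact: FD| |exact/au/FD].
  by rewrite Hlev// mem_cat QF.
have HGj j P : P \in Gj j -> [/\ E P, side P = a * 2 ^+ j & alpert_space mu E k P (v P)].
  rewrite mem_filter => /andP[/eqP <- PG]; split; [exact: GE| |exact/av/GE].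
  by rewrite Hlev// mem_cat PG orbT.
pose A i := \sum_(Q <- Fi i) u Q; pose B j := \sum_(P <- Gj j) v P.
pose x i := w i * Num.sqrt (dot (A i) (A i)).
pose y j := w j * Num.sqrt (dot (B j) (B j)).
have x0 i : 0 <= x i by rewrite mulr_ge0// sqrtr_ge0.
have y0 i : 0 <= y i by rewrite mulr_ge0// sqrtr_ge0.
have energyE D' (gD' : dyadic_grid D') H (t : cube R n -> euclid R n -> R) :
    uniq H -> (forall i Q, Q \in [seq Q <- H | lev Q == i] ->
      [/\ D' Q, side Q = a * 2 ^+ i & alpert_space mu D' k Q (t Q)]) ->
    \sum_(Q <- H) weight s Q ^+ 2 * dot (t Q) (t Q) =
    \sum_(i < L) (w i * Num.sqrt (dot (\sum_(Q <- [seq Q <- H | lev Q == i]) t Q)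
                          (\sum_(Q <- [seq Q <- H | lev Q == i]) t Q))) ^+ 2.
  move=> uH Ht; rewrite (sum_levels lev); apply: eq_bigr => i _.
  rewrite exprMn sqr_sqrtr ?dot_ge0// (alpert_pythagoras hn dblC k0 gD').
  - by rewrite mulr_sumr; apply: eq_big_seq => Q /Ht[_ sQ _]; rewrite /weight sQ.
  - by rewrite filter_uniq.
  - by move=> Q /Ht[].
have Xx : energy D s f F = \sum_i x i ^+ 2 by exact: energyE gD _ _ uF HFi.
have Yy : energy E s f G = \sum_j y j ^+ 2 by exact: energyE gE _ _ uG HGj.
have ZE : \sum_(P <- G) dot (v P) Phi = \sum_(i < L) \sum_(j < L) w i ^+ 2 * dot (A i) (B j).
  rewrite (eq_big_seq (fun P => \sum_(Q <- F) weight s Q ^+ 2 * dot (u Q) (v P))); last first.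
    move=> P PG; rewrite /Phi dot_sumr; last 2 first.
    - by move=> Q QF _; apply: L2Z; exact: L2u.
    - exact: L2v.
    apply: eq_big_seq => Q QF.
    by rewrite (dotZr _ (L2u Q QF) (L2v P PG)) (dotC mu (v P)).
  rewrite exchange_big/= (sum_levels lev); apply: eq_bigr => i _.
  rewrite exchange_big/= (sum_levels lev); apply: eq_bigr => j _.
  rewrite -/(Gj j) -/(Fi i) /A dot_suml; last 2 first.
  - by move=> Q; rewrite mem_filter => /andP[_ QF] _; exact: L2u.
  - by apply: L2_sum => P; rewrite mem_filter => /andP[_ PG] _; exact: L2v.
  rewrite exchange_big/= mulr_sumr; apply: eq_big_seq => Q.
  move=> /[dup] /HFi[_ sQ _]; rewrite mem_filter => /andP[_ QF].
  rewrite /B dot_sumr; last 2 first.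
  - by move=> P; rewrite mem_filter => /andP[_ PG] _; exact: L2v.
  - exact: L2u.
  by rewrite mulr_sumr; apply: eq_bigr => P _; rewrite /weight sQ.
have c0 : 0 < level_const by exact: lt_le_trans level_const1.
pose c := Num.sqrt level_const; have cp : 0 < c by rewrite sqrtr_gt0.
have q0 : 0 <= q by rewrite mulr_ge0 ?sqrtr_ge0// powR_ge0.
have term i j : w i ^+ 2 * dot (A i) (B j) <= c * (q ^+ gap i j * (x i * y j)).
  apply: schur_term.
  - exact: w0.
  - exact: dot_ge0.
  - exact: dot_ge0.
  - exact: ltW.
  - exact: ltW.
  - exact: powR_scale.
  have uFi : uniq (Fi i) by rewrite filter_uniq.
  have uGj : uniq (Gj j) by rewrite filter_uniq.
  exact: (level_bound gD gE uFi uGj (HFi i) (HGj j)).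
have Zle : \sum_(P <- G) dot (v P) Phi <=
    c * ((1 - q)^-1 * ((1 - q) / (2 * c) * energy D s f F +
                       ((1 - q) / (2 * c))^-1 * energy E s f G)).
  have eta0 : 0 < (1 - q) / (2 * c) by rewrite divr_gt0 ?subr_gt0 ?mulr_gt0.
  rewrite ZE Xx Yy; apply: le_trans (ler_wpM2l (ltW cp) (schur_test q0 q1 x y eta0)).
  rewrite mulr_sumr; apply: ler_sum => i _; rewrite mulr_sumr.
  by apply: ler_sum => j _; exact: term.
rewrite XE in HG; have := absorb cp q1 Zle HG.
by rewrite (sqr_sqrtr (ltW c0)).
Qed.

End main_inequality.

(** * The Sobolev norms *)

Lemma Lnorm2_sqr d (T : measurableType d) (R : realType)
    (mu : {measure set T -> \bar R}) (g : T -> R) : g \in Lfun mu 2%:E ->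
  ('N[mu]_2%:E[EFin \o g] ^+ 2 = (dot mu g g)%:E)%E.
Proof.
move=> L2g.
have Noo : ('N[mu]_2%:E[EFin \o g] < +oo)%E.
  by have := sub_Lfun_finLfun L2g; rewrite inE.
have N0 := Lnorm_ge0 mu 2%:E (EFin \o g).
have := @poweR_Lnorm _ _ _ mu (EFin \o g) 2.
rewrite pnatr_eq0 => /(_ isT).
rewrite -(@fineK _ 'N[mu]_2%:E[EFin \o g]%E) ?ge0_fin_numE//.
rewrite poweR_EFin powR_mulrn ?fine_ge0// => NE.
rewrite expe2 -EFinM -expr2 NE -dot_EFin//; apply: eq_integral => x _.
by rewrite /= powR_mulrn// real_normK ?num_real// expr2.
Qed.

Lemma poweR_half_le (R : realType) (t : \bar R) (a : R) : (0 <= t)%E -> 0 <= a ->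
  (t `^ 2^-1 <= a%:E)%E = (t <= (a ^+ 2)%:E)%E.
Proof.
move=> + a0; case: t => [t| |//] t0.
  rewrite lee_fin in t0; rewrite poweR_EFin !lee_fin powR12_sqrt//.
  by rewrite -{1}(ger0_norm a0) -sqrtr_sqr ler_sqrt// sqr_ge0.
by rewrite poweRyr ?invr_neq0// !leye_eq.
Qed.

Section alpert_norm.
Context {R : realType} {n : nat}.
Hypothesis hn : (0 < n)%N.
Variable mu : {measure set (euclid R n) -> \bar R}.
Variable C : R.
Hypothesis dblC : doubling_by mu C.
Variable k : nat.
Hypothesis k0 : (0 < k)%N.
Variable s : R.
Implicit Types (P Q : cube R n) (f g h : euclid R n -> R).
Implicit Types D E : set (cube R n).
Implicit Types F G : seq (cube R n).
Local Notation L2 := (Lfun mu 2%:E).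
Local Notation dot := (dot mu).

Lemma alpert_norm_ge0 D f : (0 <= alpert_norm mu D k s f)%E.
Proof. exact: poweR_ge0. Qed.

(** Reduces statements on the norms to finite sums of real numbers. *)
Lemma alpert_normP D f (a : R) : dyadic_grid D -> f \in L2 -> 0 <= a ->
  (alpert_norm mu D k s f <= a%:E)%E <->
  forall F, uniq F -> (forall Q, Q \in F -> D Q) -> energy mu k D s f F <= a ^+ 2.
Proof.
move=> gD L2f a0; rewrite /alpert_norm poweR_half_le//; last first.
  apply: esum_ge0 => Q _; rewrite mule_ge0 ?lee_fin ?powR_ge0//.
  by rewrite expe2 mule_ge0// Lnorm_ge0.
have termE Q : D Q -> ((side Q `^ (- 2 * s))%:E *
    'N[mu]_2%:E[EFin \o alpert_proj mu D k Q f] ^+ 2 =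
    (weight s Q ^+ 2 * dot (alpert_proj mu D k Q f) (alpert_proj mu D k Q f))%:E)%E.
  move=> DQ; rewrite Lnorm2_sqr; last exact: (Delta_L2 hn dblC k0 gD DQ L2f).
  rewrite /weight -powR_mulrn ?powR_ge0// -powRrM EFinM; congr (_%:E * _)%E.
  by congr (_ `^ _); ring.
have sumE F : uniq F -> (forall Q, Q \in F -> D Q) ->
    (\sum_(Q \in [set` F]) ((side Q `^ (- 2 * s))%:E *
    'N[mu]_2%:E[EFin \o alpert_proj mu D k Q f] ^+ 2))%E = (energy mu k D s f F)%:E.
  move=> uF FD; rewrite -fsbig_seq// /energy -sumEFin.
  by apply: eq_big_seq => Q QF; rewrite termE//; exact: FD.
split=> [le F uF FD|H].
  rewrite -lee_fin -sumE//; apply: le_trans le; apply: ereal_sup_ubound.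
  exists [set` F] => //; split; last exact: FD.
  by apply/finite_seqP; exists F.
apply: ge_ereal_sup => _ [A [finA AD] <-].
move/finite_seqP: (finA) => [F FA].
have AE : A = [set` undup F] by rewrite FA; apply/seteqP; split=> Q /=; rewrite mem_undup.
have FD Q : Q \in undup F -> D Q by move=> QF; apply: AD; rewrite AE.
by rewrite AE sumE ?undup_uniq// lee_fin H// undup_uniq.
Qed.

(** Projections are only chosen representatives; this determines their norms
    without a detour through equality almost everywhere. *)
Lemma dot_Delta_eq D Q f g : dyadic_grid D -> D Q -> f \in L2 ->
  alpert_space mu D k Q g ->
  (forall h, alpert_space mu D k Q h -> dot g h = dot f h) ->
  dot (alpert_proj mu D k Q f) (alpert_proj mu D k Q f) = dot g g.
Proof.
move=> gD DQ L2f ag gf; have [ad _] := alpert_projP hn dblC k0 gD DQ L2f.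
rewrite (dot_Delta hn dblC k0 gD DQ L2f ad) -gf// dotC.
by rewrite (dot_Delta hn dblC k0 gD DQ L2f ag) gf.
Qed.

Lemma energyD D f g F t : dyadic_grid D -> f \in L2 -> g \in L2 ->
  (forall Q, Q \in F -> D Q) -> 0 < t ->
  energy mu k D s (f + g) F <= (1 + t) * energy mu k D s f F + (1 + t^-1) * energy mu k D s g F.
Proof.
move=> gD L2f L2g FD t0; rewrite /energy !mulr_sumr -big_split/=.
rewrite big_seq_cond [leRHS]big_seq_cond; apply: ler_sum => Q /andP[/FD DQ _].
have L2d := Delta_L2 hn dblC k0 gD DQ L2f.
have L2e := Delta_L2 hn dblC k0 gD DQ L2g.
have [ad _] := alpert_projP hn dblC k0 gD DQ L2f.
have [ae _] := alpert_projP hn dblC k0 gD DQ L2g.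
rewrite (@dot_Delta_eq D Q (f + g) (alpert_proj mu D k Q f + alpert_proj mu D k Q g))//.
- rewrite mulrCA [X in _ <= _ + X]mulrCA -mulrDr.
  by apply: ler_wpM2l; [exact: sqr_ge0 | exact: dot_sqrD].
- exact: L2D.
- exact: (alpertD hn dblC k0 gD DQ ad ae).
move=> h ah; have L2h := alpert_L2 hn dblC k0 gD DQ ah.
by rewrite !dotDl// !(dot_Delta hn dblC k0 gD DQ _ ah).
Qed.

Lemma alpert_norm_cases D f : alpert_norm mu D k s f = +oo%E \/
  exists2 a : R, 0 <= a & alpert_norm mu D k s f = a%:E.
Proof.
have := alpert_norm_ge0 D f; case: alpert_norm => [a|_|//].
  by rewrite lee_fin => a0; right; exists a.
by left.
Qed.

(** Sum [energyD] over cubes with [t] the ratio of the two norms. Since these may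
    vanish, both are first increased by [e / 2]. *)
Lemma alpert_normD D f g : dyadic_grid D -> f \in L2 -> g \in L2 ->
  (alpert_norm mu D k s (f + g)%R <=
   alpert_norm mu D k s f + alpert_norm mu D k s g)%E.
Proof.
move=> gD L2f L2g.
have g0 := alpert_norm_ge0 D g.
have [->|[a a0 fa]] := alpert_norm_cases D f.
  by rewrite addye ?leey// gt_eqF// (lt_le_trans _ g0).
have [->|[b b0 gb]] := alpert_norm_cases D g; first by rewrite fa addey ?leey.
rewrite gb fa -EFinD.
apply/lee_addgt0Pr => e e0; rewrite -EFinD.
have e2 : 0 < e / 2 by rewrite divr_gt0.
have [a1 b1] : 0 < a + e / 2 /\ 0 < b + e / 2 by split; rewrite ltr_wpDl.
apply/alpert_normP => //; [exact: L2D | by rewrite !addr_ge0// ltW|].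
move=> F uF FD.
have fF : energy mu k D s f F <= (a + e / 2) ^+ 2.
  have : energy mu k D s f F <= a ^+ 2 by apply: (alpert_normP gD L2f a0).1 => //; rewrite fa.
  by move=> h; apply: (le_trans h); rewrite ler_pXn2r ?nnegrE ?lerDl// ltW.
have gF : energy mu k D s g F <= (b + e / 2) ^+ 2.
  have : energy mu k D s g F <= b ^+ 2 by apply: (alpert_normP gD L2g b0).1 => //; rewrite gb.
  by move=> h; apply: (le_trans h); rewrite ler_pXn2r ?nnegrE ?lerDl// ltW.
have t0 : 0 < (b + e / 2) / (a + e / 2) by rewrite divr_gt0.
apply: (le_trans (energyD gD L2f L2g FD t0)).
apply: (@le_trans _ _ ((1 + (b + e / 2) / (a + e / 2)) * (a + e / 2) ^+ 2 +
    (1 + ((b + e / 2) / (a + e / 2))^-1) * (b + e / 2) ^+ 2)).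
  by apply: lerD; apply: ler_wpM2l => //; rewrite addr_ge0// ?invr_ge0 ltW.
have -> : a + b + e = (a + e / 2) + (b + e / 2) by field.
move: (a + e / 2) (b + e / 2) a1 b1 => A B A0 B0.
by rewrite le_eqVlt; apply/orP; left; apply/eqP; field; rewrite !gt_eqF.
Qed.

Lemma alpert_norm0 D : dyadic_grid D -> alpert_norm mu D k s 0 = 0%E.
Proof.
move=> gD; apply/eqP; rewrite eq_le alpert_norm_ge0 andbT.
apply/alpert_normP => //; first exact: L2_0.
move=> F uF FD; rewrite /energy big_seq_cond big1 ?expr0n// => Q /andP[/FD DQ _].
by rewrite (dot_Delta_eq gD DQ (L2_0 mu) (alpert0 hn dblC k0 gD DQ))// dot0l mulr0.
Qed.

Variable K : R.
Hypothesis HK : mass_spread mu k K.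
Hypothesis s_small : Num.sqrt (rho C) * 2 `^ `|s| < 1.

Lemma alpert_norm_le : exists2 c, 0 < c & forall D E f,
  dyadic_grid D -> dyadic_grid E -> f \in L2 ->
  (alpert_norm mu D k s f <= c%:E * alpert_norm mu E k s f)%E.
Proof.
set q := Num.sqrt (rho C) * 2 `^ `|s|.
have q0 : 0 < 1 - q by rewrite subr_gt0.
have l0 : 0 < @level_const R n C K.
  by rewrite /level_const lt_max ltr01.
pose B := 4 * @level_const R n C K / (1 - q) ^+ 2.
have B0 : 0 < B by rewrite divr_gt0 ?mulr_gt0// exprn_gt0.
exists (Num.sqrt B); first by rewrite sqrtr_gt0.
move=> D E f gD gE L2f.
have [->|[b b0 gb]] := alpert_norm_cases E f.
  by rewrite gt0_muley ?leey// lte_fin sqrtr_gt0.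
rewrite gb -EFinM; apply/alpert_normP => //.
  by rewrite mulr_ge0// sqrtr_ge0.
move=> F uF FD; apply/ler_addgt0Pr => e e0.
have [G [uG GE le]] := energy_le hn dblC k0 HK gD gE L2f uF FD e0 s_small.
apply: (le_trans le); rewrite lerD2r exprMn sqr_sqrtr ?(ltW B0)//.
apply: ler_wpM2l; first exact: ltW.
by apply: (alpert_normP gE L2f b0).1 => //; rewrite gb.
Qed.

End alpert_norm.

(** * Completions *)

Section sobolev.
Context {R : realType} {n : nat}.
Hypothesis hn : (0 < n)%N.
Variable mu : {measure set (euclid R n) -> \bar R}.
Variable C : R.
Hypothesis dblC : doubling_by mu C.
Variable k : nat.
Hypothesis k0 : (0 < k)%N.
Variable s : R.
Implicit Types (f g h : euclid R n -> R) (D E : set (cube R n)).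
Implicit Types (u v : nat -> euclid R n -> R).
Local Notation L2 := (Lfun mu 2%:E).
Local Notation norm D f := (alpert_norm mu D k s f).

(** By the triangle inequality the norms form a Cauchy sequence of real numbers. *)
Lemma sobolev_cauchy_cvg D u : dyadic_grid D -> sobolev_cauchy mu D k s u ->
  cvg (norm D (u i) @[i --> \oo]).
Proof.
move=> gD [pu cu].
have /choice[r Hr] i : exists a : R, norm D (u i) = a%:E.
  have [_ fin] := pu i; have [E1|[a _ E1]] := alpert_norm_cases mu k s D (u i).
    by rewrite E1 in fin.
  by exists a.
have le i j (e : R) : (norm D (u i \- u j)%R <= e%:E)%E -> r i <= r j + e.
  move=> ije; have [[L2i _] [L2j _]] := (pu i, pu j).
  have L2ij : u i - u j \in L2 by exact: L2B.
  have := alpert_normD hn dblC k0 s gD L2ij L2j.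
  rewrite subrK Hr Hr => h; rewrite -lee_fin; apply: (le_trans h).
  by rewrite addrC EFinD; apply: leeD.
have dist (e : R) : 0 < e -> exists N : nat, forall i, (N <= i)%N -> `|r N - r i| < e.
  move=> e0; have e2 : 0 < e / 2 by rewrite divr_gt0.
  have [N HN] := cu _ e2; exists N => i Ni.
  have h1 := le _ _ _ (HN i N Ni (leqnn N)).
  have h2 := le _ _ _ (HN N i (leqnn N) Ni).
  by rewrite ltr_norml; apply/andP; split; lra.
have cr : cvg (r @ \oo).
  apply: cauchy_cvg; apply: cauchy_exP => e e0.
  have [N HN] := dist e e0; exists (r N).
  by exists N => // i /= Ni; exact: HN.
have -> : (fun i => norm D (u i)) = EFin \o r by apply/funext => i; rewrite Hr.
apply/cvg_ex; exists (lim (r @ \oo))%:E; apply/fine_cvgP; split; first exact: nearW.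
exact: cr.
Qed.

Lemma sobolev_class_refl D u : dyadic_grid D -> sobolev_cauchy mu D k s u ->
  sobolev_class mu D k s u u.
Proof.
move=> gD cu; split=> //.
have -> : (fun i => norm D (u i \- u i)%R) = cst 0%E.
  apply/funext => i; rewrite (_ : u i \- u i = 0) ?(alpert_norm0 hn dblC k0)//.
  by apply/funext => x /=; rewrite subrr.
exact: cvg_cst.
Qed.

Section comparison.
Variables D E : set (cube R n).
Hypotheses (gD : dyadic_grid D) (gE : dyadic_grid E).
Variable c : R.
Hypothesis c0 : 0 < c.
Hypothesis DE : forall f, f \in L2 -> (norm D f <= c%:E * norm E f)%E.

Lemma pre_sobolev_sub : pre_sobolev mu E k s `<=` pre_sobolev mu D k s.
Proof.
move=> f [L2f fE]; split; first exact: L2f.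
apply: (le_lt_trans (DE L2f)).
by rewrite lte_mul_pinfty// lee_fin ltW.
Qed.

Lemma sobolev_cauchy_sub u : sobolev_cauchy mu E k s u -> sobolev_cauchy mu D k s u.
Proof.
move=> [pu cu]; split=> [i|e e0]; first exact: pre_sobolev_sub.
have [N HN] := cu _ (divr_gt0 e0 c0); exists N => i j Ni Nj.
have L2ij : u i - u j \in L2 by apply: L2B; have [] := pu i; have [] := pu j.
apply: (le_trans (DE L2ij)).
have c0' : (0 <= c%:E)%E by rewrite lee_fin ltW.
apply: (le_trans (lee_wpmul2l c0' (HN i j Ni Nj))).
by rewrite -EFinM mulrC divfK// gt_eqF.
Qed.

Lemma sobolev_class_sub u : sobolev_cauchy mu E k s u ->
  sobolev_class mu E k s u `<=` sobolev_class mu D k s u.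
Proof.
move=> [pu _] v [cv uv0]; split; first exact: sobolev_cauchy_sub.
have [pv _] := cv.
have cuv : (c%:E * norm E (u i \- v i)%R)%E @[i --> \oo] --> 0%E.
  by rewrite -(mule0 c%:E); apply: cvgeZl.
apply: squeeze_cvge (cvg_cst 0%E) cuv.
apply: nearW => i; rewrite alpert_norm_ge0 /=; apply: DE.
by apply: L2B; have [] := pu i; have [] := pv i.
Qed.

Lemma sobolev_norm_le F : sobolev mu D k s F -> sobolev mu E k s F ->
  (sobolev_norm mu D k s F <= c%:E * sobolev_norm mu E k s F)%E.
Proof.
move=> [u cu uF] [u' cu' u'F].
have Fu : F u by rewrite -uF; exact: sobolev_class_refl.
have gF : F (get F) by apply: (getPex (ex_intro _ u Fu)).
have cvD : sobolev_cauchy mu D k s (get F) by move: gF; rewrite -{1}uF => -[].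
have cvE : sobolev_cauchy mu E k s (get F) by move: gF; rewrite -{1}u'F => -[].
have cD := sobolev_cauchy_cvg gD cvD; have cE := sobolev_cauchy_cvg gE cvE.
have ccE : (c%:E * norm E (get F i))%E @[i --> \oo] -->
    (c%:E * lim (norm E (get F i) @[i --> \oo]))%E by exact: cvgeZl.
rewrite /sobolev_norm -(cvg_lim _ ccE)//; apply: lee_lim.
- exact: cD.
- by apply/cvg_ex; eexists; exact: ccE.
by apply: nearW => i; apply: DE; have [/(_ i)[]] := cvD.
Qed.

End comparison.

End sobolev.

Theorem theorem17 (R : realType) (n : nat) (hn : (0 < n)%N)
    (mu : {measure set (euclid R n) -> \bar R}) :
  locally_finite mu -> doubling mu ->
  exists s0 : R, 0 < s0 /\
    forall (D E : set (cube R n)) (k : nat) (s : R),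
      dyadic_grid D -> dyadic_grid E -> (0 < k)%N -> `|s| < s0 ->
      sobolev mu D k s = sobolev mu E k s /\
      exists C : R, 0 < C /\
        forall F, sobolev mu D k s F ->
          (sobolev_norm mu D k s F <= C%:E * sobolev_norm mu E k s F)%E /\
          (sobolev_norm mu E k s F <= C%:E * sobolev_norm mu D k s F)%E.
Proof.
move=> lf dbl; have [C dblC] := locally_finite_doubling lf dbl.
have r0 : 0 < Num.sqrt (rho C) by rewrite sqrtr_gt0 (rho_gt0 dblC).
have r1 : Num.sqrt (rho C) < 1.
  by rewrite -sqrtr1 ltr_sqrt// (rho_lt1 dblC).
have ln2 : 0 < ln 2 :> R by rewrite ln_gt0// ltr1n.
(* the exponent for which Num.sqrt (rho C) * 2 `^ s0 is 1 *)
exists (- ln (Num.sqrt (rho C)) / ln 2); split.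
  by rewrite divr_gt0// oppr_gt0 ln_lt0// r0.
move=> D E k s gD gE k0 ss0.
have s_small : Num.sqrt (rho C) * 2 `^ `|s| < 1.
  rewrite -ltr_pdivlMl// mulr1 /powR pnatr_eq0/= -[ltRHS]lnK ?posrE ?invr_gt0//.
  by rewrite ltr_expR lnV// -ltr_pdivlMr.
have [K HK] := polyfun_mass dblC k0.
have [c c0 le] := alpert_norm_le hn dblC k0 HK s_small.
have DE f : f \in Lfun mu 2%:E -> _ := le D E f gD gE.
have ED f : f \in Lfun mu 2%:E -> _ := le E D f gE gD.
have cauchyE u : sobolev_cauchy mu D k s u <-> sobolev_cauchy mu E k s u.
  split.
    exact: (sobolev_cauchy_sub c0 ED).
  exact: (sobolev_cauchy_sub c0 DE).
have sobE : sobolev mu D k s = sobolev mu E k s.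
  have classE u : sobolev_cauchy mu D k s u ->
      sobolev_class mu D k s u = sobolev_class mu E k s u.
    move=> cu; apply/seteqP; split; first exact: (sobolev_class_sub c0 ED).
    exact: (sobolev_class_sub c0 DE (proj1 (cauchyE u) cu)).
  apply/seteqP; split=> F [u cu <-]; exists u.
  - exact: (proj1 (cauchyE u) cu).
  - exact: (esym (classE u cu)).
  - exact: (proj2 (cauchyE u) cu).
  - exact: (classE u (proj2 (cauchyE u) cu)).
split; first exact: sobE.
exists c; split; first exact: c0.
move=> F FD; have FE : sobolev mu E k s F by rewrite -sobE.
split.
  exact: (sobolev_norm_le hn dblC k0 gD gE DE FD FE).
exact: (sobolev_norm_le hn dblC k0 gE gD ED FE FD).
Qed.
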